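(* Consider an importance function $V$, level size $\Delta>0$ and an unbiased splitting mechanism $(q,r,w)$, and define $\bar W:D\to\mathbb{R}$ by $$\bar W(y)=\frac{\log E\,r(M)}{\Delta}\,V(y).$$ Let $x\in D\setminus(A\cup B)$ with $V(x)\ge 0$, and let $x_n\in D\setminus(A\cup B)$ be initial conditions with $x_n\to x$. Suppose that $$\bar W(y)-\bar W(z)\le\mathcal{J}(y,z)\quad\text{for all }y,z\in D\setminus(A\cup B)$$ and that $\bar W(y)\le 0$ for all $y\in B$. Assume also the following two conditions. (1) For any sequence $y_n\to x$ of initial conditions, $\lim_{n\to\infty}-\frac1n\log p^n(y_n)=W(x)$. (2) For every $z\in[0,V(x)]$, with $\sigma^n=\min\{i\ge 0: X^n_i\in A\cup L_z\}$, $$\liminf_{n\to\infty}-\frac1n\log E_{x_n}\left[1_{\{X^n_{\sigma^n}\in L_z\}}\big(p^n(X^n_{\sigma^n})\big)^2\right]\ge W(x)+\inf_{y\in\partial L_z}W(y).$$ Then $$\lim_{n\to\infty}-\frac1n\log E_{x_n}\left[\big(s^n_{\mathrm{SA}}\big)^2\right]=W(x)-V(x)\,\frac{\log\left(E\sum_{i=1}^{r(M)}w_i(M)^2\right)}{\Delta}.$$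
   Context: Setting: $D\subset\mathbb{R}^d$ is a domain, and for each $n$, $\{X^n_i\}_{i\ge 0}$ is a discrete-time, $D$-valued Markov process with stationary transition probabilities. $A,B$ are disjoint subsets of $D$. $\tau^n=\min\{i\ge 0: X^n_i\in A\cup B\}$ and $p^n(y)=P\{\tau^n<\infty,\ X^n_{\tau^n}\in B\mid X^n_0=y\}$. $E_y$ denotes expectation for initial condition $y$. Indicators of events such as $\{X^n_{\sigma^n}\in L_z\}$ are $0$ when $\sigma^n=\infty$. $L:\mathbb{R}^d\times\mathbb{R}^d\to[0,\infty]$ is a given function (the local rate function). For $y\in D$, $$W(y)=\inf\int_0^t L(\phi(s),\dot\phi(s))\,ds,$$ the infimum being over all $t<\infty$ and all absolutely continuous $\phi:[0,t]\to D$ with $\phi(0)=y$, $\phi(t)\in B$ and $\phi(s)\notin A$ for all $s\in[0,t]$. For $y,z\in D$, $$\mathcal{J}(y,z)=\inf\int_0^t L(\phi(s),\dot\phi(s))\,ds,$$ the infimum being over all $t<\infty$ and all absolutely continuous $\phi:[0,t]\to D$ with $\phi(0)=y$, $\phi(t)=z$. Importance function and levels: $V:D\to\mathbb{R}$ is continuous with $V(y)\le 0$ for all $y\in B$, and $\Delta>0$. Let $L_z=\{y\in D: V(y)\le z\}$ (boundary $\partial L_z$), $C^n_0=B$, $C^n_j=L_{(j-1)\Delta/n}$ for $j\ge 1$, and $l^n(y)=\min\{j\ge 0: y\in C^n_j\}$. Splitting mechanism $(q,r,w)$: $q$ is a probability distribution on $\{1,\dots,J\}$; for each $j\in\{1,\dots,J\}$,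 $r(j)$ is a nonnegative integer with $r(j)\le R<\infty$ and $w(j)=(w_1(j),\dots,w_{r(j)}(j))\in\mathbb{R}_+^{r(j)}$. $M$ denotes a random variable with law $q$. The mechanism is unbiased if $E\sum_{i=1}^{r(M)}w_i(M)=1$. Splitting algorithm: generation $0$ consists of one particle at $x_n$ with weight $1$. For $r=1,\dots,l^n(x_n)$, each particle of generation $r-1$, at position $\xi$ with weight $\omega$, is treated independently of all other particles as follows. Run a sample $Z_i$ of the process with the law of $X^n$ started at $Z_0=\xi$, and let $\tau=\inf\{i\ge 0: Z_i\in A\cup C^n_{l^n(x_n)-r}\}$. If $\tau<\infty$ and $Z_\tau\notin A$, draw an independent $M$ with law $q$ and add to generation $r$ exactly $r(M)$ particles located at $Z_\tau$, the $k$-th with weight $w_k(M)\,\omega$. Otherwise the particle produces no descendants. (Here $r$ as generation index and $r(\cdot)$ as offspring number are different objects.) Let $N^n_r$ be the number of particles in generation $r$ and $w^n_{r,j}$, $1\le j\le N^n_r$, their weights. The sample produced is $$s^n_{\mathrm{SA}}=\sum_{j=1}^{N^n_{l^n(x_n)}} w^n_{l^n(x_n),j}.$$ *)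

(* Defs.v *)
From HB Require Import structures.
From mathcomp Require Import all_boot all_order all_algebra.
From mathcomp Require Import all_classical all_reals all_analysis.

Set Implicit Arguments.
Unset Strict Implicit.
Unset Printing Implicit Defensive.

Import Order.TTheory GRing.Theory Num.Theory.
Import numFieldNormedType.Exports.

Local Open Scope classical_set_scope.
Local Open Scope ring_scope.

(* The norm on row vectors is the sup norm, which is
   equivalent to the Euclidean one and induces the usual topology of R^d. *)

(* Row vectors carry the Borel sigma-algebra. *)
HB.instance Definition _ (R : realType) (m n : nat) :=
  @isMeasurable.Build (sigma_display (@open 'M[R]_(m, n))) 'M[R]_(m, n)
    <<s @open 'M[R]_(m, n) >> (@sigma_algebra0 _ setT _)
    (@sigma_algebraC _ _) (@sigma_algebra_bigcup _ setT _).

(* Least index satisfying [P]; [None] stands for the minimum of the empty set,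
   i.e. +oo. *)
Definition first_index (P : nat -> Prop) : option nat :=
  match pselect (exists i, `[< P i >]) with
  | left h => Some (ex_minn h)
  | right _ => None
  end.

Definition hitting_time (T : Type) (S : set T) (z : nat -> T) : option nat :=
  first_index (fun i => S (z i)).

Section variational_functions.
Context {R : realType} {d : nat}.
Implicit Types (D A B : set 'rV[R]_d) (phi : R -> 'rV[R]_d).

Definition abs_continuous_on (a b : R) phi : Prop :=
  forall e : R, 0 < e -> exists2 del : R, 0 < del &
    forall (k : nat) (u v : 'I_k -> R),
      (forall i, [/\ a <= u i, u i <= v i & v i <= b]) ->
      (forall i j, i != j -> v i <= u j \/ v j <= u i) ->
      \sum_(i < k) (v i - u i) < del ->
      \sum_(i < k) `|phi (v i) - phi (u i)| < e.

(* [derive1 phi] is the two-sided derivative.  It exists almost everywhere on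
   [[0, t]] when [phi] is absolutely continuous there, and its arbitrary
   values elsewhere (endpoints included) are on a null set. *)
Definition action (L : 'rV[R]_d -> 'rV[R]_d -> \bar R) (t : R) phi : \bar R :=
  (\int[lebesgue_measure]_(s in `[0%R, t]%classic) L (phi s) (derive1 phi s))%E.

Definition trajectory D (t : R) phi : Prop :=
  [/\ 0 <= t, abs_continuous_on 0 t phi &
      forall s, 0 <= s <= t -> D (phi s)].

Definition W_fun D A B L (y : 'rV[R]_d) : \bar R :=
  ereal_inf [set a | exists t phi,
    [/\ trajectory D t phi, phi 0 = y, B (phi t),
        (forall s, 0 <= s <= t -> ~ A (phi s)) & a = action L t phi]].

Definition J_fun D L (y z : 'rV[R]_d) : \bar R :=
  ereal_inf [set a | exists t phi,
    [/\ trajectory D t phi, phi 0 = y, phi t = z & a = action L t phi]].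

End variational_functions.

(* A [D]-valued Markov chain with stationary transition kernel [chain_ker]:
   for [y] in [D], [chain_law y] is the probability under which the chain starts
   at [y].  The kernel is defined on all of R^d, but only its values at points
   of [D] matter. *)
Record markov_chain (R : realType) (d : nat) (D : set 'rV[R]_d) := MarkovChain {
  chain_disp : measure_display ;
  chain_space : measurableType chain_disp ;
  chain_law : 'rV[R]_d -> probability chain_space R ;
  chain : nat -> chain_space -> 'rV[R]_d ;
  chain_ker : R.-pker 'rV[R]_d ~> 'rV[R]_d ;
  chain_measurable : forall i, measurable_fun [set: chain_space] (chain i) ;
  chain_in : forall i v, D (chain i v) ;
  chain_start : forall y, D y -> chain_law y [set v | chain 0%N v = y] = 1%E ;
  (* Markov property with respect to the natural filtration *)
  chain_markov : forall y, D y ->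
    forall (i : nat) (F : set chain_space) (U : set 'rV[R]_d),
      <<s [set G | exists k S,
             [/\ (k <= i)%N, measurable S & G = chain k @^-1` S]] >> F ->
      measurable U ->
      chain_law y (F `&` chain i.+1 @^-1` U) =
      (\int[chain_law y]_(v in F) chain_ker (chain i v) U)%E
}.
Arguments chain_law {R d D}.
Arguments chain {R d D}.

Definition path_of {R : realType} {d : nat} {D : set 'rV[R]_d}
    (X : markov_chain D) (v : chain_space X) : nat -> 'rV[R]_d :=
  fun i => chain X i v.

Definition hit_prob {R : realType} {d : nat} {D : set 'rV[R]_d}
    (X : markov_chain D) (A B : set 'rV[R]_d) (y : 'rV[R]_d) : \bar R :=
  chain_law X y [set v | if hitting_time (A `|` B) (path_of v) is Some i
                         then B (chain X i v) else False].

Definition cross_moment {R : realType} {d : nat} {D : set 'rV[R]_d}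
    (X : markov_chain D) (A B S : set 'rV[R]_d) (y : 'rV[R]_d) : \bar R :=
  (\int[chain_law X y]_v
     if hitting_time (A `|` S) (path_of v) is Some i
     then (\1_S (chain X i v))%:E * hit_prob X A B (chain X i v) ^+ 2
     else 0)%E.

(* [q] is a distribution on ['I_J]; outcome [j] produces [offspring j]
   descendants with weight factors [weight j].  As [J] is finite, the offspring
   numbers are automatically bounded. *)
Record splitting_mechanism (R : realType) (J : nat) := SplittingMechanism {
  mech_law : 'I_J -> R ;
  offspring : 'I_J -> nat ;
  weight : forall j, 'I_(offspring j) -> R ;
  mech_law_ge0 : forall j, 0 <= mech_law j ;
  mech_law_sum1 : \sum_j mech_law j = 1 ;
  weight_ge0 : forall j k, 0 <= @weight j k
}.

Definition mech_E {R : realType} {J : nat} (m : splitting_mechanism R J)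
    (f : 'I_J -> R) : R := \sum_j mech_law m j * f j.

Definition unbiased {R : realType} {J : nat} (m : splitting_mechanism R J) :=
  mech_E m (fun j => \sum_(k < offspring m j) weight k) = 1.

Section levels.
Context {R : realType} {d : nat}.
Variables (D B : set 'rV[R]_d) (V : 'rV[R]_d -> R) (Delta : R).

Definition sublevel (z : R) : set 'rV[R]_d := [set y | D y /\ V y <= z].

Definition sublevel_boundary (z : R) : set 'rV[R]_d :=
  D `&` (closure (sublevel z) `\` interior (sublevel z)).

Definition C_level (n j : nat) : set 'rV[R]_d :=
  if j is j'.+1 then sublevel (j'%:R * Delta / n%:R) else B.

(* The default value is only used when no level contains [y], which happens
   for no [y] in [D] as soon as [n > 0] and [Delta > 0]. *)
Definition level_index (n : nat) (y : 'rV[R]_d) : nat :=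
  odflt 0%N (first_index (fun j => C_level n j y)).

End levels.

Section splitting_generations.
Context {R : realType} {d J : nat} (mech : splitting_mechanism R J).
Variables (A : set 'rV[R]_d) (C : nat -> set 'rV[R]_d) (l : nat)
  (x : 'rV[R]_d).
Context {Omega : Type}.
Variables (Z : nat -> nat -> nat -> Omega -> 'rV[R]_d)
  (M : nat -> nat -> Omega -> 'I_J).

(* A particle is a pair (position, weight). *)
Definition descendants (S : set 'rV[R]_d) (z : nat -> 'rV[R]_d) (m : 'I_J)
    (omega : R) : seq ('rV[R]_d * R) :=
  if hitting_time (A `|` S) z is Some i then
    if `[< A (z i) >] then [::]
    else [seq (z i, weight k * omega) | k <- enum 'I_(offspring mech m)]
  else [::].

(* [Z r j] and [M r j] are the sample path and the splitting variable attached
   to the [j]-th particle of generation [r]; they are unused for [j] at least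
   the size of that generation. *)
Fixpoint generation (r : nat) (w : Omega) : seq ('rV[R]_d * R) :=
  if r is r'.+1 then
    flatten [seq descendants (C (l - r)%N) (fun i => Z r' j i w) (M r' j w)
                   (nth (x, 1) (generation r' w) j).2
            | j <- iota 0 (size (generation r' w))]
  else [:: (x, 1)].

Definition splitting_history (r : nat) : set (set Omega) :=
  <<s [set F | exists r' j i U,
         [/\ (r' < r)%N, measurable U &
             F = [set w | (j < size (generation r' w))%N /\ U (Z r' j i w)]]]
      `|`
      [set F | exists r' j m,
         (r' < r)%N /\
         F = [set w | (j < size (generation r' w))%N /\ M r' j w = m]] >>.

Definition splitting_sample (w : Omega) : R :=
  \sum_(p <- generation l w) p.2.

End splitting_generations.

(* A run of the splitting algorithm with targets [C (l - 1), ..., C 0] started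
   from a particle at [x].  [run_law] says that, conditionally on the history of
   the generations before [r], the paths and splitting variables attached to the
   particles of generation [r] are all independent, the path of a particle at
   [xi] having the law of the chain started at [xi] and the splitting variables
   having law [mech_law].  Path laws are tested on cylinder sets, and [K] is a
   common length for the cylinders. *)
Record splitting_run (R : realType) (d J : nat) (D : set 'rV[R]_d)
    (X : markov_chain D) (mech : splitting_mechanism R J)
    (A : set 'rV[R]_d) (C : nat -> set 'rV[R]_d) (l : nat) (x : 'rV[R]_d) :=
  SplittingRun {
  run_disp : measure_display ;
  run_space : measurableType run_disp ;
  run_prob : probability run_space R ;
  run_path : nat -> nat -> nat -> run_space -> 'rV[R]_d ;
  run_mark : nat -> nat -> run_space -> 'I_J ;
  run_path_measurable : forall r j i,
    measurable_fun [set: run_space] (run_path r j i) ;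
  run_mark_measurable : forall r j m, measurable (run_mark r j @^-1` [set m]) ;
  run_path_in : forall r j i w, D (run_path r j i w) ;
  run_law :
    let gen := generation mech A C l x run_path run_mark in
    forall (r : nat) (F : set run_space), (r < l)%N ->
      splitting_history mech A C l x run_path run_mark r F ->
    forall (N K : nat) (U : nat -> nat -> set 'rV[R]_d) (m : nat -> 'I_J),
      (forall j i, measurable (U j i)) ->
      run_prob [set w | [/\ F w, size (gen r w) = N &
        forall j, (j < N)%N ->
          (forall i, (i < K)%N -> U j i (run_path r j i w)) /\
          run_mark r j w = m j]] =
      (\int[run_prob]_(w in F `&` [set w | size (gen r w) = N])
         \prod_(j < N)
           (chain_law X (nth (x, 1%R) (gen r w) j).1
              [set v | forall i, (i < K)%N -> U j i (chain X i v)]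
            * (mech_law mech (m j))%:E))%E
}.

Definition s_SA {R : realType} {d J : nat} {D : set 'rV[R]_d}
    {X : markov_chain D} {mech : splitting_mechanism R J}
    {A : set 'rV[R]_d} {C : nat -> set 'rV[R]_d} {l : nat} {x : 'rV[R]_d}
    (S : splitting_run X mech A C l x) : run_space S -> R :=
  splitting_sample mech A C l x (@run_path _ _ _ _ _ _ _ _ _ _ S)
    (@run_mark _ _ _ _ _ _ _ _ _ _ S).

(* [- (1/n) log a] for [a] in [[0, +oo]], with [log 0 = -oo]. *)
Definition rate {R : realType} (n : nat) (a : \bar R) : \bar R :=
  ((- n%:R^-1)%:E * lne a)%E.

(* Main.v *)
(* Let p be the probability of hitting B before A, rho = E r(M), and
   kappa = E sum w_i(M)^2. Since p is invariant under hitting the successive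
   levels, the sum of weight * p(position) over a generation is a martingale,
   and computing its second moment level by level gives
     kappa^l p(x) <= E s^2 <= p(x)^2 + c sum_(r < l) kappa^r E[p(X_r)^2],
   where X_r is the chain at its first visit to the level of generation r + 1
   and c = E (sum w_i(M))^2. By Cauchy-Schwarz rho * kappa >= 1, and W >= Wbar
   because Wbar is a subsolution; hence W >= - z log kappa / Delta on the
   boundary of L_z, so that the hypothesis on the cross moments makes every term
   of the sum at most of the exponential order of kappa^l p(x). By Jensen's
   inequality and the strong Markov property the cross moment decreases with the
   level, so finitely many values of z give this bound uniformly in r. *)

Require Import Defs.
From HB Require Import structures.
From mathcomp Require Import all_boot all_order all_algebra finmap.
From mathcomp Require Import all_classical all_reals all_analysis.
From mathcomp Require Import measurable_realfun ring lra zify.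
Import Order.TTheory GRing.Theory Num.Theory.
Import numFieldNormedType.Exports.
Local Open Scope classical_set_scope.
Local Open Scope ring_scope.

Set Implicit Arguments.
Unset Strict Implicit.
Unset Printing Implicit Defensive.

(** * Induction on nonnegative measurable functions *)

(** The law of a run is known only through cylinder events of bounded length, whereas paths are
    evaluated at hitting times, which are unbounded. Hitting is therefore treated by an operator
    [pot] built from the transition kernel alone, as a series over the hitting time. The strong
    Markov property becomes an identity between such operators, proved by minimality of a fixed
    point. For the algorithm, the pairs made of a functional of a path and a mark and of its mean
    are closed under scaling and countable sums; this carries the conditional independence within a
    generation from cylinders to hitting values. Everything is nonnegative and takes values in
    [\bar R], so integrability is never at stake. The sign of log kappa is not prescribed: if it is
    nonnegative, W >= 0 suffices on the level boundary; if it is negative, log rho >= - log kappa is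
    positive and V >= z on the boundary of L_z does the rest. The subsolution inequality holds only
    outside A and B while the paths end in B, so it is used up to times shortly before the entrance
    into B, and continuity bridges the gap. *)

Section nonnegative_functions.
Context {R : realType}.
Local Open Scope ereal_scope.

(** The factor may be [+oo]: then either every term vanishes or one positive term makes both sides
    infinite. *)
Lemma nneseriesZle (f : nat -> \bar R) (x : \bar R) :
  0 <= x -> (forall i, 0 <= f i) ->
  \sum_(i <oo) (x * f i) = x * \sum_(i <oo) f i.
Proof.
case: x => [x| |] // x0 f0; first by rewrite nneseriesZl.
have [f00|/existsNP[k fk]] := pselect (forall i, f i = 0).
  by rewrite !eseries0 ?mule0// => i _ _; rewrite f00 mule0.
have fk0 : 0 < f k by rewrite lt_neqAle f0 andbT eq_sym; exact/eqP.
rewrite (@eseries_pinfty _ _ _ k)//; last 2 first.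
- by move=> n _; rewrite gt_eqF// (lt_le_trans ltNy0)// mule_ge0.
- by rewrite gt0_mulye.
by rewrite gt0_mulye// (lt_le_trans fk0)// (@nneseriesD1 _ _ k)// leeDl// nneseries_ge0.
Qed.

(** Writes a sum of two as a series, so that closure under countable sums also gives closure under
    addition. *)
Lemma nneseries_add0 (f g : \bar R) :
  0 <= f -> 0 <= g ->
  \sum_(i <oo) (if i is j.+1 then if j is _.+1 then 0 else g else f) = f + g.
Proof.
move=> f0 g0.
have h0 k : 0 <= (if k is j.+1 then if j is _.+1 then 0 else g else f).
  by case: k => [|[|k]].
rewrite nneseries_recl//=; congr (_ + _).
rewrite (@nneseries_split _ _ 1 1)//= big_nat1 eseries0 ?adde0//.
by case=> [|[|]].
Qed.

Context d (T : measurableType d).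

Import HBSimple HBNNSimple.

(** With increasing simple approximations [s n] of [f], the identity
    [f = s 0 + \sum_n (s n.+1 - s n)] presents [f] as a countable sum of nonnegative simple
    functions. Countable sums thus take the place of monotone limits. *)
Lemma nnfun_ind (P : (T -> \bar R) -> Prop) :
  (forall U, measurable U -> P (fun x => (\1_U x)%:E)) ->
  (forall (c : R) (f : T -> \bar R), (0 <= c)%R -> measurable_fun setT f -> (forall x, 0 <= f x) ->
     P f -> P (fun x => c%:E * f x)) ->
  (forall f_ : nat -> T -> \bar R, (forall n, measurable_fun setT (f_ n)) ->
     (forall n x, 0 <= f_ n x) -> (forall n, P (f_ n)) ->
     P (fun x => \sum_(n <oo) f_ n x)) ->
  forall f : T -> \bar R, measurable_fun setT f -> (forall x, 0 <= f x) -> P f.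
Proof.
move=> Pind PZ Psum f mf f0.
have Padd g h : measurable_fun setT g -> measurable_fun setT h ->
    (forall x, 0 <= g x) -> (forall x, 0 <= h x) -> P g -> P h -> P (g \+ h).
  move=> mg mh g0 h0 Pg Ph.
  have -> : g \+ h = fun x => \sum_(i <oo)
     (if i is j.+1 then if j is _.+1 then (fun y => (\1_(@set0 T) y)%:E) else h else g) x.
    apply/funext => x /=; rewrite -nneseries_add0//.
    by apply: eq_eseriesr => -[|[|]] //= _ _; rewrite indic0.
  apply: Psum => -[|[|n]] //=; last exact: Pind.
  exact/measurable_EFinP.
have Pnnsfun (g : {nnsfun T >-> R}) : P (fun x => (g x)%:E).
  have -> : (fun x => (g x)%:E) = fun x =>
      \sum_(y <- finmap.enum_fset (fset_set (range g))) (y * \1_(g @^-1` [set y]) x)%:E.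
    by apply/funext => x; rewrite fimfunE fsbig_finite//= sumEFin.
  have : forall y, y \in finmap.enum_fset (fset_set (range g)) -> (0 <= y)%R.
    move=> y ys; have : y \in fset_set (range g) by [].
    by rewrite in_fset_set// inE/= => -[x _ <-].
  elim: (finmap.enum_fset _) => [_|y s ih ys].
    under eq_fun do rewrite big_nil -[0]/((0%R)%:E).
    have -> : (fun=> 0%:E) = fun x : T => (\1_(@set0 T) x)%:E :> \bar R.
      by apply/funext => x; rewrite indic0.
    exact: Pind.
  under eq_fun do rewrite big_cons.
  have ms c : measurable_fun setT (fun x => (\1_(g @^-1` [set c]) x)%:E : \bar R).
    exact/measurable_EFinP/measurable_indic.
  apply: Padd.
  - by under eq_fun do rewrite EFinM; exact: measurable_funeM.
  - by apply: emeasurable_sum => c; under eq_fun do rewrite EFinM; exact: measurable_funeM.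
  - by move=> x; rewrite lee_fin mulr_ge0// ys// mem_head.
  - move=> x; rewrite big_seq; apply: sume_ge0 => z zs.
    by rewrite lee_fin mulr_ge0// ys// in_cons zs orbT.
  - under eq_fun do rewrite EFinM; apply: PZ => //; first by rewrite ys// mem_head.
    exact: Pind.
  - by apply: ih => z zs; rewrite ys// in_cons zs orbT.
pose s := nnsfun_approx measurableT mf.
have nd n x : (s n x <= s n.+1 x)%R.
  by have /lefP := nd_nnsfun_approx measurableT mf (leqnSn n); exact.
pose D n : T -> \bar R := fun x => ((s n.+1 x - s n x)%R)%:E.
have mD n : measurable_fun setT (D n).
  exact/measurable_EFinP/measurable_funB.
have D0 n x : 0 <= D n x by rewrite lee_fin subr_ge0.
(* The difference is written as a sum with [-1] times [s n] to inherit the structure of a simple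
   function; its sign comes from monotonicity in [n]. *)
have PD n : P (D n).
  have -> : D n = fun x => (((s n.+1 \+ (cst (-1) \* s n))%R : T -> R) x)%:E.
    by apply/funext => x; rewrite /D/= mulN1r.
  have h0 : forall x, (0 <= ((s n.+1 \+ (cst (-1) \* s n))%R : T -> R) x)%R.
    by move=> x /=; rewrite mulN1r subr_ge0.
  pose h : {sfun T >-> R} := [the {sfun _ >-> _} of (s n.+1 \+ (cst (-1) \* s n))%R].
  pose mix := isNonNegFun.Build _ _ h h0.
  pose g : {nnsfun T >-> R} := HB.pack (h : T -> R) (HBSimple.SimpleFun.class h) mix.
  exact: (Pnnsfun g).
have sumD n x : \sum_(0 <= i < n) D i x = (s n x - s 0%N x)%:E.
  elim: n => [|n ih]; first by rewrite big_geq// subrr.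
  by rewrite big_nat_recr//= ih -EFinD addrC addrA subrK.
have -> : f = (fun x => (s 0%N x)%:E) \+ (fun x => \sum_(n <oo) D n x).
  apply/funext => x /=.
  have h : \sum_(n <oo) D n x = f x - (s 0%N x)%:E.
    apply/cvg_lim => //; under eq_fun do rewrite sumD.
    under eq_fun do rewrite EFinB.
    apply: cvgeB => //; last exact: cvg_cst.
      by rewrite fin_num_adde_defl.
    exact: cvg_nnsfun_approx.
  by rewrite h addeC subeK.
apply: Padd => //; last exact: Psum.
- exact/measurable_EFinP.
- have -> : (fun x => \sum_(n <oo) D n x) = fun x => \sum_(n <oo | n \in xpredT) D n x by [].
  exact: ge0_emeasurable_sum.
- by move=> x; rewrite lee_fin.
- by move=> x; apply: nneseries_ge0.
Qed.

End nonnegative_functions.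

(** * Hitting operators of a Markov kernel *)

Section potential.
Local Open Scope ereal_scope.
Context {R : realType} {d} {T : measurableType d} (K : R.-pker T ~> T).
Variable A : set T.
Implicit Types (S U N : set T) (f g : T -> \bar R).

(** One step of the chain killed outside [N]: no step is made from a point that is not in [N]. *)
Definition kill N f y := (\1_N y)%:E * \int[K y]_z f z.

(** Contribution of the paths that meet the union of [A] and [S] exactly at time [i]. *)
Definition potn S i f := iter i (kill (~` (A `|` S))) (fun y => (\1_(S `\` A) y)%:E * f y).

(* [pot S f y] is the mean of [f] at the hitting point of [A `|` S] by the chain
   started at [y], on the event that this point exists and is outside [A]. *)
Definition pot S f y := \sum_(i <oo) potn S i f y.

Lemma kill_ge0 N f y : (forall z, 0 <= f z) -> 0 <= kill N f y.
Proof. by move=> f0; rewrite mule_ge0// ?lee_fin//; exact: integral_ge0. Qed.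

Lemma measurable_kill N f : measurable N -> (forall z, 0 <= f z) ->
  measurable_fun setT f -> measurable_fun setT (kill N f).
Proof.
move=> mN f0 mf; apply: emeasurable_funM; first exact/measurable_EFinP.
apply: measurable_fun_integral_kernel => // U mU; exact: measurable_kernel.
Qed.

Lemma iter_kill_ge0 N f i y : (forall z, 0 <= f z) -> 0 <= iter i (kill N) f y.
Proof. by move=> f0; elim: i y => //= i ih y; exact: kill_ge0. Qed.

Lemma measurable_iter_kill N f i : measurable N -> (forall z, 0 <= f z) ->
  measurable_fun setT f -> measurable_fun setT (iter i (kill N) f).
Proof.
move=> mN f0 mf; elim: i => //= i ih.
by apply: measurable_kill => // z; exact: iter_kill_ge0.
Qed.

Hypothesis mA : measurable A.

Lemma potn_ge0 S f i y : (forall z, 0 <= f z) -> 0 <= potn S i f y.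
Proof. by move=> f0; apply: iter_kill_ge0 => z; rewrite mule_ge0// lee_fin. Qed.

Lemma measurable_potn S f i : measurable S -> (forall z, 0 <= f z) ->
  measurable_fun setT f -> measurable_fun setT (potn S i f).
Proof.
move=> mS f0 mf; apply: measurable_iter_kill.
- by apply: measurableC; exact: measurableU.
- by move=> z; rewrite mule_ge0// lee_fin.
- apply: emeasurable_funM => //; apply/measurable_EFinP/measurable_indic.
  exact: measurableD.
Qed.

Lemma pot_ge0 S f y : (forall z, 0 <= f z) -> 0 <= pot S f y.
Proof. by move=> f0; apply: nneseries_ge0 => n _ _; exact: potn_ge0. Qed.

Lemma measurable_pot S f : measurable S -> (forall z, 0 <= f z) ->
  measurable_fun setT f -> measurable_fun setT (pot S f).
Proof.
move=> mS f0 mf.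
apply: (@ge0_emeasurable_sum _ _ _ setT (fun i => potn S i f) xpredT).
  by move=> i y _ _; exact: potn_ge0.
by move=> i _; exact: measurable_potn.
Qed.

(** First-step analysis: the term [i = 0] is the value at the start, and the remaining terms share
    one killed step, which leaves the series by monotone convergence. *)
Lemma pot_fix S f y : measurable S -> (forall z, 0 <= f z) -> measurable_fun setT f ->
  pot S f y = (\1_(S `\` A) y)%:E * f y + kill (~` (A `|` S)) (pot S f) y.
Proof.
move=> mS f0 mf; rewrite /pot (@nneseries_split _ _ 0 1); last by move=> *; exact: potn_ge0.
rewrite add0n big_nat1; congr (_ + _).
rewrite /kill integral_nneseries//; last 2 first.
- by move=> n; exact: measurable_potn.
- by move=> n x _; exact: potn_ge0.
rewrite -nneseriesZl; last by move=> i _; apply: integral_ge0 => z _; exact: potn_ge0.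
rewrite -(@nneseries_addn _ (fun i => potn S i f y) 1); last by move=> i; exact: potn_ge0.
by apply: eq_eseriesr => i _; rewrite addn1.
Qed.

Lemma le_kill N f g y : (forall z, 0 <= f z) -> measurable_fun setT f ->
  measurable_fun setT g -> (forall z, f z <= g z) -> kill N f y <= kill N g y.
Proof.
move=> f0 mf mg fg; rewrite lee_wpmul2l ?lee_fin//.
by apply: ge0_le_integral => // z _; exact: le_trans (fg z).
Qed.

(** [pot S f] is the least nonnegative supersolution of the equation in [pot_fix]: by induction
    every partial sum of its series stays below [g]. *)
Lemma pot_le S f g y : measurable S -> (forall z, 0 <= f z) ->
  measurable_fun setT f -> (forall z, 0 <= g z) -> measurable_fun setT g ->
  (forall z, (\1_(S `\` A) z)%:E * f z + kill (~` (A `|` S)) g z <= g z) ->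
  pot S f y <= g y.
Proof.
move=> mS f0 mf g0 mg fg.
apply: lime_le; first by apply: is_cvg_nneseries => n _ _; exact: potn_ge0.
apply: nearW => n; elim: n y => [|n ih] y; first by rewrite big_geq.
apply: le_trans (fg y); rewrite big_nat_recl//= leeD2l//.
have -> : \sum_(0 <= i < n) kill (~` (A `|` S)) (potn S i f) y =
    kill (~` (A `|` S)) (fun z => \sum_(0 <= i < n) potn S i f z) y.
  rewrite /kill ge0_integral_sum//; last 2 first.
  - by move=> i; exact: measurable_potn.
  - by move=> i z _; exact: potn_ge0.
  by rewrite ge0_sume_distrr// => i _; apply: integral_ge0 => z _; exact: potn_ge0.
apply: le_kill => //.
- by move=> z; apply: sume_ge0 => i _; exact: potn_ge0.
- by apply: emeasurable_sum => i; exact: measurable_potn.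
Qed.

(** The strong Markov property at the hitting of [S], without stopping times: each side is a
    supersolution of the equation that defines the other, so [pot_le] gives both inequalities. *)
Lemma pot_pot S S' f y : measurable S -> measurable S' -> S' `<=` S ->
  (forall z, 0 <= f z) -> measurable_fun setT f ->
  pot S (pot S' f) y = pot S' f y.
Proof.
move=> mS mS' SS f0 mf.
have u0 := fun z => pot_ge0 S' z f0.
have mu := measurable_pot mS' f0 mf.
have le1 z : pot S (pot S' f) z <= pot S' f z.
  apply: pot_le => // {}z; rewrite indicE in_setD.
  have [zA|zA] := boolP (z \in A); rewrite ?andbF ?andbT.
    by rewrite mul0e add0e /kill indicE in_setC in_setU zA/= mul0e.
  have [zS|zS] := boolP (z \in S).
    by rewrite mul1e /kill indicE in_setC in_setU zS orbT/= mul0e adde0.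
  rewrite mul0e add0e [leRHS]pot_fix// /kill !indicE !in_setC !in_setU (negbTE zA).
  rewrite in_setD (negbTE zS)/=.
  have /negbTE -> /= : z \notin S'.
    by apply: contra zS; rewrite !inE => /SS.
  by rewrite mul0e add0e.
apply/eqP; rewrite eq_le le1/=.
apply: (pot_le _ mS' f0 mf).
- by move=> z; exact: pot_ge0.
- exact: measurable_pot.
move=> z; have [zS|zS] := boolP (z \in S `\` A); last first.
  have [zA|zA] := boolP (z \in A).
    rewrite indicE in_setD zA andbF mul0e add0e.
    by rewrite /kill indicE in_setC in_setU zA/= mul0e pot_ge0.
  have zS1 : z \notin S by move: zS; rewrite in_setD zA andbT.
  have zS2 : z \notin S' by apply: contra zS1; rewrite !inE => /SS.
  rewrite [leRHS]pot_fix// /kill !indicE !in_setC !in_setU !in_setD.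
  by rewrite (negbTE zA) (negbTE zS1) (negbTE zS2)/= mul0e add0e leeDr// mule_ge0.
(* At a point of [S] outside [A] the chain has already arrived, so the outer operator does
   nothing. *)
have e : pot S (pot S' f) z = pot S' f z.
  move: zS; rewrite in_setD => /andP[zS zA].
  rewrite pot_fix// /kill !indicE in_setD in_setC in_setU zS (negbTE zA)/=.
  by rewrite mul1e mul0e adde0.
rewrite e [leRHS](pot_fix _ mS' f0 mf); apply: leeD2l; apply: le_kill => //; last exact: measurable_pot.
by move=> w; exact: pot_ge0.
Qed.

End potential.

(** * Borel sets of row vectors and indicators *)

Lemma measurable_open {R : realType} {m n} (U : set 'M[R]_(m, n)) : open U -> measurable U.
Proof. exact: sub_sigma_algebra. Qed.

Lemma measurable_closed {R : realType} {m n} (U : set 'M[R]_(m, n)) : closed U -> measurable U.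
Proof.
by move=> cU; rewrite -(setCK U); apply: measurableC; apply: measurable_open; exact: closed_openC.
Qed.

Lemma measurable_point {R : realType} {n} (y : 'rV[R]_n) : measurable [set y].
Proof.
apply: measurable_closed; apply: accessible_closed_set1.
by apply: hausdorff_accessible; exact: norm_hausdorff.
Qed.

Lemma integral_indicl {R : realType} d (T : measurableType d)
    (mu : {measure set T -> \bar R}) (F : set T) (f : T -> \bar R) :
  (\int[mu]_(x in F) f x = \int[mu]_x ((\1_F x)%:E * f x))%E.
Proof.
rewrite integral_mkcond; apply: eq_integral => x _; rewrite patchE indicE.
by case: ifP; rewrite ?mul1e ?mul0e.
Qed.

Lemma indic_preimage {R : pzRingType} T U (f : T -> U) (S : set U) x :
  \1_S (f x) = \1_[set y | S (f y)] x :> R.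
Proof. by rewrite !indicE; congr _%:R; congr nat_of_bool; apply/idP/idP; rewrite !inE. Qed.

(** * Hitting values along the chain *)

Section first_index.
Implicit Types (P : nat -> Prop) (T : Type).

Lemma first_indexP P i :
  first_index P = Some i <-> P i /\ forall k, (k < i)%N -> ~ P k.
Proof.
rewrite /first_index; case: pselect => [h|h]; last first.
  by split=> // -[Pi _]; case: h; exists i; exact: asboolT.
case: ex_minnP => m /asboolW Pm mP; split=> [[<-]|[Pi Pk]].
  by split=> // k km Pk; have := mP k (asboolT Pk); rewrite leqNgt km.
congr Some; apply/eqP; rewrite eqn_leq mP ?andTb; last exact: asboolT.
by rewrite leqNgt; apply/negP => mi; exact: (Pk _ mi).
Qed.

Lemma first_indexN P : first_index P = None <-> forall k, ~ P k.
Proof.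
rewrite /first_index; case: pselect => [h|h]; split=> //.
- by case: h => i Pi /(_ i); have := asboolW Pi.
- by move=> _ k Pk; apply: h; exists k; exact: asboolT.
Qed.

End first_index.

Section hitting_value.
Local Open Scope ereal_scope.
Context {R : realType} {T : Type}.
Implicit Types (A S N : set T) (f : T -> \bar R) (z : nat -> T).

(** Pathwise counterpart of [pot], which is its mean under the law of the chain ([chain_hitval]). *)
Definition hitval A S f z : \bar R :=
  if hitting_time (A `|` S) z is Some i then
    if `[< A (z i) >] then 0 else f (z i)
  else 0.

Definition stays N n : set (nat -> T) := [set z | forall k, (k < n)%N -> N (z k)].

(** Only the term at the hitting time can be nonzero. Each term depends on finitely many coordinates
    of the path, which makes the Markov property and the cylinder form of the run law applicable. *)
Lemma hitval_series A S f z : (forall y, 0 <= f y) ->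
  hitval A S f z = \sum_(i <oo) ((\1_(stays (~` (A `|` S)) i) z)%:E *
                               ((\1_(S `\` A) (z i))%:E * f (z i))).
Proof.
move=> f0; rewrite /hitval; case E : (hitting_time _ z) => [i|].
  have [zi zk] := (first_indexP _ _).1 E.
  have z1 : stays (~` (A `|` S)) i z by [].
  rewrite (@nneseriesD1 _ _ i)//; last by move=> k _; rewrite !mule_ge0// lee_fin.
  rewrite eseries0 ?adde0.
    rewrite !indicE mem_set// mul1e; case: asboolP => Azi.
      by rewrite memNset ?mul0e// => -[].
    by rewrite mem_set ?mul1e//; split=> //; case: zi.
  move=> k _ /= ki; have [lki|] := ltnP k i.
    rewrite [X in _ * (X * _)](_ : _ = 0) ?mul0e ?mule0//.
    rewrite indicE memNset// => -[Sz _]; apply: (zk _ lki); by right.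
  rewrite leq_eqVlt eq_sym (negbTE ki)/= => lik.
  by rewrite indicE memNset ?mul0e// => /(_ _ lik); apply.
have zk := (first_indexN _).1 E.
rewrite eseries0// => k _ _; rewrite [X in _ * (X * _)](_ : _ = 0) ?mul0e ?mule0//.
by rewrite indicE memNset// => -[Sz _]; apply: (zk k); right.
Qed.

Lemma hitval_ge0 A S f z : (forall y, 0 <= f y) -> 0 <= hitval A S f z.
Proof. by move=> f0; rewrite /hitval; case: hitting_time => // i; case: ifP. Qed.

End hitting_value.

Lemma measurable_stays d (U : measurableType d) T (Y : nat -> U -> T) (N : set T) n :
  (forall k, (k < n)%N -> measurable (Y k @^-1` N)) ->
  measurable [set v | stays N n (Y ^~ v)].
Proof.
elim: n => [_|n ih mY].
  by rewrite [X in measurable X](_ : _ = setT)//; apply/seteqP; split=> v //= _ k.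
rewrite [X in measurable X](_ : _ = [set v | stays N n (Y ^~ v)] `&` Y n @^-1` N).
  by apply: measurableI; [apply: ih => k kn; apply: mY; exact: ltnW|exact: mY].
apply/seteqP; split=> v; first by move=> h; split=> [k kn|]; apply: h => //; exact: ltnW.
move=> [h Nn] k; rewrite /= ltnS leq_eqVlt => /orP[/eqP -> //|]; exact: h.
Qed.

Lemma stays_chain T (N : set T) n (z : nat -> T) (R : realType) :
  (\1_(stays N n.+1) z = \1_(stays N n) z * \1_N (z n) :> R).
Proof.
rewrite !indicE; have [h|h] := pselect (stays N n.+1 z).
  by rewrite !mem_set ?mulr1//; [exact: h|move=> k kn; apply: h; exact: ltnW].
rewrite (memNset h); have [h1|h1] := pselect (stays N n z); last first.
  by rewrite (memNset h1) mul0r.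
rewrite [z n \in N]memNset ?mulr0// => Nn; apply: h => k.
by rewrite ltnS leq_eqVlt => /orP[/eqP -> //|]; exact: h1.
Qed.

Section chain.
Local Open Scope ereal_scope.
Context {R : realType} {d : nat} {D : set 'rV[R]_d} (X : markov_chain D).
Implicit Types (A S N : set 'rV[R]_d) (f g : 'rV[R]_d -> \bar R).

Lemma measurable_chain_preimage i S : measurable S -> measurable (chain X i @^-1` S).
Proof. by move=> mS; have := @chain_measurable _ _ _ X i measurableT _ mS; rewrite setTI. Qed.

Let past i : set (set (chain_space X)) := [set G | exists k S,
  [/\ (k <= i)%N, measurable S & G = chain X k @^-1` S]].

Let past_measurable i F : <<s past i >> F -> measurable F.
Proof.
apply: smallest_sub; first exact: sigma_algebra_measurable.
move=> _ [k [S [_ mS ->]]].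
exact: measurable_chain_preimage.
Qed.

Lemma measurable_chain_comp i f : measurable_fun setT f ->
  measurable_fun setT (fun v => f (chain X i v)).
Proof. by move=> mf; apply: measurableT_comp => //; exact: chain_measurable. Qed.

(** The Markov property passes from indicators to nonnegative functions by [nnfun_ind]. *)
Lemma chain_step y i F g : D y -> <<s past i >> F ->
  measurable_fun setT g -> (forall z, 0 <= g z) ->
  \int[chain_law X y]_(v in F) g (chain X i.+1 v) =
  \int[chain_law X y]_(v in F) \int[chain_ker X (chain X i v)]_z g z.
Proof.
move=> Dy pF mg g0; have mF := past_measurable pF.
have mK f : measurable_fun setT f -> (forall z, 0 <= f z) ->
    measurable_fun setT (fun z => \int[chain_ker X z]_w f w).
  by move=> mf f0; apply: measurable_fun_integral_kernel => // U mU; exact: measurable_kernel.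
have mX j f : measurable_fun setT f -> measurable_fun F (fun v => f (chain X j v)).
  move=> mf; exact: (measurable_funTS (D := F) (measurable_chain_comp j mf)).
move: g mg g0; apply: nnfun_ind.
- move=> U mU; transitivity (chain_law X y (F `&` chain X i.+1 @^-1` U)).
    have mXU : measurable (chain X i.+1 @^-1` U).
      exact: measurable_chain_preimage.
    rewrite setIC -(integral_indic _ mF)//.
  rewrite chain_markov//; apply: eq_integral => v _.
  by rewrite integral_indic// setIT.
- move=> c f c0 mf f0 ih.
  rewrite (ge0_integralZl_EFin _ mF (fun v _ => f0 _) (mX i.+1 f mf) c0) ih.
  rewrite -(ge0_integralZl_EFin _ mF _ (mX i _ (mK f mf f0)) c0); last first.
    by move=> v _; exact: integral_ge0.
  by apply: eq_integral => v _; rewrite ge0_integralZl_EFin.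
- move=> f mf f0 ih.
  rewrite (integral_nneseries _ mF (fun n => mX i.+1 _ (mf n)) (fun n v _ => f0 n _)).
  under eq_eseriesr do rewrite ih.
  rewrite -(integral_nneseries _ mF (fun n => mX i _ (mK _ (mf n) (f0 n)))).
    by apply: eq_integral => v _; rewrite integral_nneseries.
  by move=> n v _; exact: integral_ge0.
Qed.

(** The induction removes the last step: conditioning at time [n] turns [g] at time [n.+1] into one
    killed step of [g] at time [n]. *)
Lemma chain_stays y N n g : D y -> measurable N ->
  measurable_fun setT g -> (forall z, 0 <= g z) ->
  \int[chain_law X y]_v ((\1_(stays N n) (path_of v))%:E * g (chain X n v)) =
  iter n (kill (chain_ker X) N) g y.
Proof.
move=> Dy mN; elim: n g => [|n ih] g mg g0.
  (* The chain starts at [y] almost surely. *)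
  have -> : \int[chain_law X y]_v ((\1_(stays N 0) (path_of v))%:E * g (chain X 0%N v)) =
            \int[chain_law X y]_v (cst (g y) v).
    apply: ge0_ae_eq_integral => //.
    - under eq_fun do rewrite indicE mem_set// mul1e.
      exact: measurable_chain_comp.
    - by move=> v _; rewrite mule_ge0// lee_fin.
    - by move=> v _; exact: g0.
    have mE : measurable [set v | chain X 0 v = y].
      exact: (measurable_chain_preimage 0 (measurable_point y)).
    exists (~` [set v | chain X 0 v = y]); split.
    - exact: measurableC.
    - by rewrite [LHS]probability_setC// chain_start// subee.
    - move=> v /= h h1; apply: h => _; rewrite h1 indicE mem_set ?mul1e//.
  by rewrite integral_cst// [X in _ * X]probability_setT mule1.
rewrite iterSr -ih//; last 2 first.
- exact: measurable_kill.
- by move=> z; exact: kill_ge0.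
have pF : <<s past n >> [set v | stays N n.+1 (path_of (X := X) v)].
  apply: (@measurable_stays _ (g_sigma_algebraType (past n))) => k kn.
  by apply: sub_sigma_algebra; exists k, N; split.
have e1 (h : chain_space X -> \bar R) :
    \int[chain_law X y]_v ((\1_(stays N n.+1) (path_of v))%:E * h v) =
    \int[chain_law X y]_(v in [set v | stays N n.+1 (path_of (X := X) v)]) h v.
  by rewrite [RHS]integral_indicl; apply: eq_integral => v _; rewrite indic_preimage.
rewrite e1 chain_step// -e1; apply: eq_integral => v _.
by rewrite stays_chain EFinM -muleA.
Qed.

(** The bridge between kernel and chain: the series of [hitval] is integrated term by term, and each
    term is an iterate of the killed kernel. It holds from points of [D], the only ones where
    [chain_law] is tied to the kernel. *)
Lemma chain_hitval y A S f : D y -> measurable A -> measurable S ->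
  measurable_fun setT f -> (forall z, 0 <= f z) ->
  \int[chain_law X y]_v hitval A S f (path_of v) = pot (chain_ker X) A S f y.
Proof.
move=> Dy mA mS mf f0.
have mN : measurable (~` (A `|` S)) by apply: measurableC; exact: measurableU.
have m1 : measurable_fun setT (fun z => (\1_(S `\` A) z)%:E * f z).
  by apply: emeasurable_funM => //; apply/measurable_EFinP/measurable_indic; exact: measurableD.
have p1 z : 0 <= (\1_(S `\` A) z)%:E * f z by rewrite mule_ge0// lee_fin.
under eq_integral do rewrite hitval_series//.
rewrite integral_nneseries//; last 2 first.
- move=> n; apply: emeasurable_funM; last exact: (measurable_chain_comp n m1).
  apply/measurable_EFinP.
  have -> : (fun v => \1_(stays (~` (A `|` S)) n) (path_of v)) =
     (\1_[set v | stays (~` (A `|` S)) n (path_of (X := X) v)] : _ -> R).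
    by apply/funext => v; rewrite indic_preimage.
  apply: measurable_indic; apply: measurable_stays => k _.
  by apply: measurable_chain_preimage.
- by move=> n v _; rewrite mule_ge0// lee_fin.
apply: eq_eseriesr => n _.
by rewrite (@chain_stays y _ n (fun z => (\1_(S `\` A) z)%:E * f z)).
Qed.

End chain.

(** Jensen's inequality for the square: integrate [2 c u <= u ^ 2 + c ^ 2] with [c] the mean of [u].
    The bound by 1 makes [u] and [c] finite, so that this inequality can be checked in [R]. *)
Lemma sqr_integral_le {R : realType} d (T : measurableType d) (P : probability T R)
    (u : T -> \bar R) : measurable_fun setT u -> (forall v, 0 <= u v <= 1)%E ->
  ((\int[P]_v u v) ^+ 2 <= \int[P]_v (u v ^+ 2))%E.
Proof.
move=> mu u01.
have u0 v : (0 <= u v)%E by case/andP: (u01 v).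
pose c := (\int[P]_v u v)%E.
have c0 : (0 <= c)%E by exact: integral_ge0.
have c1 : (c <= 1)%E.
  have <- : (\int[P]_v (cst 1 v) = 1 :> \bar R)%E.
    by rewrite integral_cst// [X in (_ * X)%E]probability_setT mule1.
  by apply: ge0_le_integral => // v _; case/andP: (u01 v).
have cfin : c \is a fin_num by rewrite ge0_fin_numE// (le_lt_trans c1)// ltry.
have m2 : measurable_fun setT (fun v => u v ^+ 2)%E by under eq_fun do rewrite expe2; exact: emeasurable_funM.
have le2 v : ((2 * fine c)%:E * u v <= u v ^+ 2 + c ^+ 2)%E.
  have ufin : u v \is a fin_num.
    by rewrite ge0_fin_numE// (le_lt_trans (proj2 (andP (u01 v))))// ltry.
  rewrite -(fineK ufin) -(fineK cfin) !expe2 -!EFinM -EFinD lee_fin/=.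
  by have := sqr_ge0 (fine (u v) - fine c); nra.
have : (\int[P]_v ((2 * fine c)%:E * u v) <= \int[P]_v (u v ^+ 2 + c ^+ 2))%E.
  apply: ge0_le_integral => //.
  - by move=> v _; rewrite mule_ge0// lee_fin mulr_ge0// fine_ge0.
  - exact: measurable_funeM.
  - by apply: emeasurable_funD.
rewrite ge0_integralZl_EFin//; last by rewrite mulr_ge0// fine_ge0.
rewrite ge0_integralD//; last 2 first.
- by move=> v _; exact: expe_ge0.
- by move=> v _; exact: expe_ge0.
rewrite integral_cst// [X in (_ ^+ 2 * X)%E]probability_setT mule1 -/c.
rewrite -(fineK cfin) -EFinM; set I := (\int[P]_v _)%E.
rewrite expe2 -EFinM => h.
have -> : (fine c * fine c)%:E = ((2 * fine c * fine c) - fine c * fine c)%:E :> \bar R.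
  by rewrite mulrDl mul1r mulrDl addrK.
by rewrite EFinB leeBlDr.
Qed.

(** * Hitting probabilities and cross moments *)

Section hitting_probability.
Local Open Scope ereal_scope.
Context {R : realType} {d : nat} {D : set 'rV[R]_d} (X : markov_chain D).
Implicit Types (S : set 'rV[R]_d) (f g : 'rV[R]_d -> \bar R).
Variable A : set 'rV[R]_d.
Hypothesis mA : measurable A.
Local Notation pot := (pot (chain_ker X) A).

Lemma measurable_hitval_chain S f : measurable S -> measurable_fun setT f ->
  (forall z, 0 <= f z) ->
  measurable_fun setT (fun v => hitval A S f (path_of (X := X) v)).
Proof.
move=> mS mf f0.
have m1 : measurable_fun setT (fun z => (\1_(S `\` A) z)%:E * f z).
  by apply: emeasurable_funM => //; apply/measurable_EFinP/measurable_indic; exact: measurableD.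
have mN : measurable (~` (A `|` S)) by apply: measurableC; exact: measurableU.
pose h i v := (\1_(stays (~` (A `|` S)) i) (path_of (X := X) v))%:E *
  ((\1_(S `\` A) (chain X i v))%:E * f (chain X i v)).
have -> : (fun v => hitval A S f (path_of (X := X) v)) =
    fun v => \sum_(i <oo | i \in xpredT) h i v.
  by apply/funext => v; rewrite hitval_series//.
apply: ge0_emeasurable_sum => [i v _ _|i _]; first by rewrite !mule_ge0// lee_fin.
apply: emeasurable_funM; last exact: (measurable_chain_comp i m1).
apply/measurable_EFinP.
have -> : (fun v => \1_(stays (~` (A `|` S)) i) (path_of v)) =
   (\1_[set v | stays (~` (A `|` S)) i (path_of (X := X) v)] : _ -> R).
  by apply/funext => v; rewrite indic_preimage.
apply: measurable_indic; apply: measurable_stays => k _.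
by apply: measurable_chain_preimage.
Qed.

Lemma le_hitval S f g z : (forall i, f (z i) <= g (z i)) -> hitval A S f z <= hitval A S g z.
Proof. by move=> fg; rewrite /hitval; case: hitting_time => // i; case: ifP. Qed.

(** The comparison is assumed on [D] only, which the kernel operator does not see; the proof passes
    to the chain, whose paths stay in [D]. *)
Lemma le_pot S f g y : D y -> measurable S -> measurable_fun setT f ->
  measurable_fun setT g -> (forall z, 0 <= f z) -> (forall z, 0 <= g z) ->
  (forall z, D z -> f z <= g z) -> pot S f y <= pot S g y.
Proof.
move=> Dy mS mf mg f0 g0 fg; rewrite -!chain_hitval//.
apply: ge0_le_integral => //.
- by move=> v _; exact: hitval_ge0.
- exact: measurable_hitval_chain.
- exact: measurable_hitval_chain.
by move=> v _; apply: le_hitval => i; apply: fg; exact: chain_in.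
Qed.

Lemma pot_in S f y : measurable S -> measurable_fun setT f -> (forall z, 0 <= f z) ->
  A y -> pot S f y = 0.
Proof.
move=> mS mf f0 Ay; rewrite pot_fix// /kill !indicE memNset ?mul0e ?add0e; last by case.
by rewrite memNset ?mul0e//; apply; left.
Qed.

Lemma pot_on S f y : measurable S -> measurable_fun setT f -> (forall z, 0 <= f z) ->
  (S `\` A) y -> pot S f y = f y.
Proof.
move=> mS mf f0 Sy; rewrite pot_fix// /kill !indicE mem_set ?mul1e//.
by rewrite memNset ?mul0e ?adde0//; apply; right; case: Sy.
Qed.

(** [hitval] is 0 or the value at a single point, so it commutes with squaring, and Jensen's
    inequality applies under the law of the chain. *)
Lemma pot_sqr S f y : D y -> measurable S -> measurable_fun setT f ->
  (forall z, 0 <= f z) -> (forall z, D z -> f z <= 1) ->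
  (pot S f y) ^+ 2 <= pot S (fun z => f z ^+ 2) y.
Proof.
move=> Dy mS mf f0 f1.
have m2 : measurable_fun setT (fun z => f z ^+ 2).
  by under eq_fun do rewrite expe2; exact: emeasurable_funM.
rewrite -!chain_hitval//; last by move=> z; exact: expe_ge0.
have -> : \int[chain_law X y]_v hitval A S (fun z => f z ^+ 2) (path_of v) =
   \int[chain_law X y]_v (hitval A S f (path_of v) ^+ 2).
  apply: eq_integral => v _; rewrite /hitval.
  case: hitting_time => [i|]; last by rewrite expe2 mul0e.
  by case: ifP => //; rewrite expe2 mul0e.
apply: sqr_integral_le; first exact: measurable_hitval_chain.
move=> v; rewrite hitval_ge0//= /hitval; case: hitting_time => // i.
by case: ifP => // _; apply: f1; exact: chain_in.
Qed.

Variable B : set 'rV[R]_d.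
Hypothesis mB : measurable B.
Hypothesis AB : A `&` B = set0.

(** The kernel form of [hit_prob]: it agrees with it on [D] and is measurable on the whole space by
    construction. *)
Definition reach := pot B (cst 1).

Lemma measurable_reach : measurable_fun setT reach.
Proof. exact: measurable_pot. Qed.

Lemma reach_ge0 z : 0 <= reach z.
Proof. exact: pot_ge0. Qed.

Lemma hit_prob_reach y : D y -> hit_prob X A B y = reach y.
Proof.
move=> Dy; rewrite /reach -chain_hitval// /hit_prob.
set E := [set v | _].
(* Disjointness of [A] and [B] makes a hit of [B] the same as a hit outside [A]. *)
have hE v : hitval A B (cst (1 : \bar R)) (path_of (X := X) v) = (\1_E v)%:E.
  rewrite /hitval indicE; case H : (hitting_time _ _) => [i|]; last first.
    by rewrite memNset// /E /= H.
  have [[Ai|Bi] _] := (first_indexP _ _).1 H.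
    rewrite asboolT// memNset// /E /= H => Bi.
    by have : (A `&` B) (chain X i v) by []; rewrite AB.
  rewrite asboolF; first by rewrite mem_set// /E /= H.
  by move=> Ai; have : (A `&` B) (chain X i v) by []; rewrite AB.
have mE : measurable E.
  have mh := measurable_hitval_chain mB (@measurable_cst _ _ _ _ setT 1) (fun z => lee01).
  have := mh measurableT [set 1] (emeasurable_set1 1).
  rewrite setTI => h.
  suff -> : E = [set v | hitval A B (cst (1 : \bar R)) (path_of (X := X) v) = 1] by exact: h.
  rewrite predeqE => v; rewrite /= hE indicE; split=> [Ev|].
    by rewrite mem_set.
  by have [/set_mem//|_ /eqP] := boolP (v \in E); rewrite eqe eq_sym oner_eq0.
under eq_integral do rewrite hE.
by rewrite integral_indic// setIT.
Qed.

Lemma reach_le1 y : D y -> reach y <= 1.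
Proof.
move=> Dy; rewrite /reach -chain_hitval//.
have I1 : \int[chain_law X y]_v (cst 1 v) = 1 :> \bar R.
  by rewrite integral_cst// [X in _ * X]probability_setT mule1.
rewrite -[leRHS]I1; apply: ge0_le_integral => //.
- by move=> v _; apply: hitval_ge0.
- exact: measurable_hitval_chain.
by move=> v _; rewrite /hitval; case: hitting_time => // i; case: ifP.
Qed.

Let mreach2 : measurable_fun setT (fun z => reach z ^+ 2).
Proof.
by under eq_fun do rewrite expe2; apply: emeasurable_funM; exact: measurable_reach.
Qed.

Let reach2_ge0 z : 0 <= reach z ^+ 2.
Proof. by rewrite expe_ge0// reach_ge0. Qed.

Lemma pot_reach S y : measurable S -> B `<=` S -> pot S reach y = reach y.
Proof. by move=> mS BS; exact: pot_pot. Qed.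

(** [cross_moment] keeps the points of [A] that lie in [S] and [pot] discards them; the two agree
    because [reach] vanishes on [A]. *)
Lemma cross_moment_pot S y : D y -> measurable S ->
  cross_moment X A B S y = pot S (fun z => reach z ^+ 2) y.
Proof.
move=> Dy mS; rewrite -chain_hitval//; apply: eq_integral => v _; rewrite /hitval.
case H : (hitting_time _ _) => [i|//].
have [ASi _] := (first_indexP _ _).1 H.
rewrite hit_prob_reach; last exact: chain_in.
have [Ai|Ai] := pselect (A (chain X i v)).
  by rewrite asboolT// /reach (pot_in mB)// expe2 mul0e mule0.
by rewrite asboolF// indicE mem_set ?mul1e//; case: ASi.
Qed.

(** Jensen's inequality applied to the invariance [pot_reach]. *)
Lemma reach_sqr_le S y : D y -> measurable S -> B `<=` S ->
  reach y ^+ 2 <= pot S (fun z => reach z ^+ 2) y.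
Proof.
move=> Dy mS BS; rewrite -{1}(pot_reach y mS BS).
by apply: pot_sqr => //; [exact: measurable_reach|exact: reach_ge0|exact: reach_le1].
Qed.

Lemma pot_reach_sqr_le S S' y : D y -> measurable S -> measurable S' ->
  B `<=` S' -> S' `<=` S ->
  pot S (fun z => reach z ^+ 2) y <= pot S' (fun z => reach z ^+ 2) y.
Proof.
move=> Dy mS mS' BS' S'S; rewrite -[leRHS](@pot_pot _ _ _ _ _ mA S S')//.
apply: le_pot => //; first exact: measurable_pot.
- by move=> z; exact: pot_ge0.
- by move=> z Dz; exact: reach_sqr_le.
Qed.

End hitting_probability.

(** * Measurability of the generations *)

Section seq_measurable.
Context d (T : measurableType d) d' (E : measurableType d') (x0 : E).
Implicit Types (g h : T -> seq E).

(** Measurability of a random finite sequence through its entries, with no sigma-algebra on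
    sequences; a full [U] gives the events on the length. *)
Definition seq_measurable g := forall j (U : set E), measurable U ->
  measurable [set w | (j < size (g w))%N /\ U (nth x0 (g w) j)].

Lemma seq_measurable_size_gt g j : seq_measurable g ->
  measurable [set w | (j < size (g w))%N].
Proof.
move=> /(_ j setT measurableT); rewrite (_ : mkset _ = [set w | (j < size (g w))%N])//.
by apply/seteqP; split=> w //= [].
Qed.

Lemma seq_measurable_size g n : seq_measurable g -> measurable [set w | size (g w) = n].
Proof.
move=> mg; case: n => [|n].
  rewrite (_ : mkset _ = ~` [set w | (0 < size (g w))%N]).
    by apply: measurableC; exact: seq_measurable_size_gt.
  by apply/seteqP; split=> w /=; [move=> ->|move/negP; rewrite -eqn0Ngt => /eqP].
rewrite (_ : mkset _ = [set w | (n < size (g w))%N] `\` [set w | (n.+1 < size (g w))%N]).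
  by apply: measurableD; exact: seq_measurable_size_gt.
apply/seteqP; split=> w /=; first by move=> ->; rewrite !ltnS leqnn ltnn; split.
by move=> [h /negP]; rewrite -leqNgt => h'; apply/eqP; rewrite eqn_leq h' h.
Qed.

Lemma seq_measurable_nth g j : seq_measurable g ->
  measurable_fun setT (fun w => nth x0 (g w) j).
Proof.
move=> mg _ U mU; rewrite setTI.
rewrite (_ : _ @^-1` U = [set w | (j < size (g w))%N /\ U (nth x0 (g w) j)] `|`
    (~` [set w | (j < size (g w))%N] `&` [set w | U x0])).
  apply: measurableU; first exact: mg.
  apply: measurableI; first by apply: measurableC; exact: seq_measurable_size_gt.
  have [Ux|Ux] := pselect (U x0).
    by rewrite (_ : mkset _ = setT)//; apply/seteqP; split.
  by rewrite (_ : mkset _ = set0)//; apply/seteqP; split.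
apply/seteqP; split=> w /=.
  have [jg|jg] := ltnP j (size (g w)); first by left.
  by rewrite nth_default// => Ux; right.
by move=> [[]//|[/negP + Ux]]; rewrite -leqNgt => jg; rewrite nth_default.
Qed.

Lemma seq_measurable_cst s : seq_measurable (cst s).
Proof.
move=> j U mU; have [P|P] := pselect ((j < size s)%N /\ U (nth x0 s j)).
  by rewrite (_ : mkset _ = setT)//; apply/seteqP; split.
by rewrite (_ : mkset _ = set0)//; apply/seteqP; split.
Qed.

Lemma seq_measurable_cat g h : seq_measurable g -> seq_measurable h ->
  seq_measurable (fun w => g w ++ h w).
Proof.
move=> mg mh j U mU.
rewrite (_ : mkset _ = [set w | (j < size (g w))%N /\ U (nth x0 (g w) j)] `|`
  \bigcup_(n in [set n | (n <= j)%N]) ([set w | size (g w) = n] `&`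
    [set w | (j - n < size (h w))%N /\ U (nth x0 (h w) (j - n))])).
  apply: measurableU; first exact: mg.
  apply: bigcup_measurable => n _; apply: measurableI; last exact: mh.
  exact: seq_measurable_size.
apply/seteqP; split=> w /=; rewrite size_cat nth_cat.
  have [jg [_ Uj]|gj [jh Uj]] := ltnP j (size (g w)); first by left.
  by right; exists (size (g w)) => //; split=> //=; split=> //; rewrite ltn_subLR.
move=> [[jg Uj]|[n /= nj [e [jh Uj]]]].
  by rewrite jg ltn_addr.
have jn : (j < n)%N = false by rewrite ltnNge nj.
by rewrite e jn -ltn_subLR.
Qed.

Lemma seq_measurable_flatten (f : nat -> T -> seq E) s :
  (forall j, seq_measurable (f j)) ->
  seq_measurable (fun w => flatten [seq f j w | j <- s]).
Proof.
move=> mf; elim: s => [|j s ih] /=; first exact: seq_measurable_cst.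
exact: seq_measurable_cat.
Qed.

(** Allows a random length [n w] to be treated as a constant. *)
Lemma seq_measurable_patch (n : T -> nat) (g_ : nat -> T -> seq E) :
  (forall k, measurable [set w | n w = k]) -> (forall k, seq_measurable (g_ k)) ->
  seq_measurable (fun w => g_ (n w) w).
Proof.
move=> mn mg j U mU.
rewrite (_ : mkset _ = \bigcup_k ([set w | n w = k] `&`
   [set w | (j < size (g_ k w))%N /\ U (nth x0 (g_ k w) j)])).
  by apply: bigcupT_measurable => k; apply: measurableI => //; exact: mg.
by apply/seteqP; split=> w /=; [exists (n w)|move=> [k _ [/= <-]]].
Qed.

Lemma measurable_sum_seq {R : realType} (g : T -> seq E) (F : E -> \bar R) :
  seq_measurable g -> measurable_fun setT F -> (forall e, 0 <= F e)%E ->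
  measurable_fun setT (fun w => \sum_(e <- g w) F e)%E.
Proof.
move=> mg mF F0.
(* A sum of random length becomes a series with fixed indices, cut off by indicators. *)
have -> : (fun w => \sum_(e <- g w) F e)%E = fun w =>
    (\sum_(j <oo | j \in xpredT) ((\1_[set w | (j < size (g w))%N] w)%:E * F (nth x0 (g w) j)))%E.
  apply/funext => w; rewrite (@nneseries_split _ _ 0 (size (g w))); last first.
    by move=> k _; rewrite mule_ge0// lee_fin.
  rewrite add0n eseries0 ?adde0; last first.
    by move=> k gk _; rewrite indicE memNset ?mul0e//= ltnNge gk.
  rewrite (big_nth x0) !big_nat; apply: eq_bigr => j /andP[_ jg].
  by rewrite indicE mem_set ?mul1e.
apply: ge0_emeasurable_sum => [j w _ _|j _]; first by rewrite mule_ge0// lee_fin.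
apply: emeasurable_funM; last exact: measurableT_comp (seq_measurable_nth j mg).
by apply/measurable_EFinP/measurable_indic; exact: seq_measurable_size_gt.
Qed.

End seq_measurable.

Section generation_measurable.
Context {R : realType} {d J : nat} (mech : splitting_mechanism R J).
Variables (A : set 'rV[R]_d) (C : nat -> set 'rV[R]_d) (l : nat) (x : 'rV[R]_d).
Context d0 (T : measurableType d0).
Variables (Z : nat -> nat -> nat -> T -> 'rV[R]_d) (M : nat -> nat -> T -> 'I_J).
Hypotheses (mA : measurable A) (mC : forall j, measurable (C j)).

Notation gen := (generation mech A C l x Z M).

(** [T] is an arbitrary measurable space, so that the lemma serves both for the full sigma-algebra
    of a run and for the one generated by the history. The hypotheses concern existing particles
    only, since the history records no others. *)
Lemma generation_step_measurable r :
  seq_measurable (x, 1 : R) (gen r) ->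
  (forall j i (U : set 'rV[R]_d), measurable U ->
     measurable [set w | (j < size (gen r w))%N /\ U (Z r j i w)]) ->
  (forall j m, measurable [set w | (j < size (gen r w))%N /\ M r j w = m]) ->
  seq_measurable (x, 1 : R) (gen r.+1).
Proof.
move=> mg mZ mM; pose S := C (l - r.+1).
(* The path of a nonexistent particle is replaced by the constant [x], which makes [Y] measurable
   with respect to the history. *)
pose Y j i w := if (j < size (gen r w))%N then Z r j i w else x.
have mY j i : measurable_fun setT (Y j i).
  move=> _ U mU; rewrite setTI.
  rewrite (_ : _ @^-1` U = [set w | (j < size (gen r w))%N /\ U (Z r j i w)] `|`
      (~` [set w | (j < size (gen r w))%N] `&` [set w | U x])).
    apply: measurableU; first exact: mZ.
    apply: measurableI; first by apply: measurableC; exact: (seq_measurable_size_gt j mg).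
    have [Ux|Ux] := pselect (U x).
      by rewrite (_ : mkset _ = setT)//; apply/seteqP; split.
    by rewrite (_ : mkset _ = set0)//; apply/seteqP; split.
  apply/seteqP; split=> w /=; rewrite /Y.
    by case: ifPn => jg; [left|right; split=> //; exact/negP].
  by case=> [[-> //]|[/negP/negbTE -> //]].
pose desc j w := if (j < size (gen r w))%N then
   descendants mech A S (fun i => Z r j i w) (M r j w) (nth (x, 1) (gen r w) j).2
  else [::].
have gE w : gen r.+1 w = flatten [seq desc j w | j <- iota 0 (size (gen r w))].
  rewrite /=; congr flatten; apply/eq_in_map => j; rewrite mem_iota add0n /= => jg.
  by rewrite /desc jg.
have mdesc j : seq_measurable (x, 1 : R) (desc j).
  move=> k U mU.
  (* Particle [j] exists with mark [m], meets the target at time [i] outside [A], and its child of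
     weight factor [c] lies in [U]. The event sought is a union of these over [i] and [m]. *)
  pose W (i : nat) (m : 'I_J) (c : R) := [set w | (j < size (gen r w))%N /\ M r j w = m] `&`
    [set w | stays (~` (A `|` S)) i (Y j ^~ w)] `&` (Y j i @^-1` (S `\` A)) `&`
    [set w | U (Y j i w, c * (nth (x, 1) (gen r w) j).2)].
  have mW i m c : measurable (W i m c).
    have mS : measurable S by exact: mC.
    apply: measurableI; [apply: measurableI; [apply: measurableI|]|].
    - exact: mM.
    - apply: measurable_stays => n _; rewrite -[X in measurable X]setTI; apply: mY => //.
      by apply: measurableC; exact: measurableU.
    - by rewrite -[X in measurable X]setTI; apply: mY => //; exact: measurableD.
    - have mf : measurable_fun setT (fun w => (Y j i w, c * (nth (x, 1) (gen r w) j).2)).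
        apply: measurable_fun_pair => //; apply: measurable_funM => //.
        by apply: measurableT_comp => //; exact: (seq_measurable_nth j mg).
      by rewrite -[X in measurable X]setTI; exact: mf.
  rewrite (_ : mkset _ = \bigcup_i \bigcup_m
     if insub k is Some k' then W i m (@weight _ _ mech m k') else set0).
    apply: bigcupT_measurable => i; apply: fin_bigcup_measurable => // m _.
    by case: insub.
  apply/seteqP; split=> w /=.
    rewrite /desc; case: ifPn => jg; last by case.
    rewrite /descendants.
    case H : hitting_time => [i|]; last by case.
    have [ASi zk] := (first_indexP _ _).1 H.
    case: asboolP => [_|Ai]; first by case.
    rewrite size_map size_enum_ord => -[km Uk].
    exists i => //; exists (M r j w) => //.
    rewrite insubT; split; [split; [split=> //|]|].
    + by move=> n ni /=; rewrite /Y jg; exact: zk.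
    + by rewrite /= /Y jg; split=> //; case: ASi.
    + rewrite /= /Y jg; move: Uk; rewrite (nth_map (Ordinal km)) ?size_enum_ord//.
      by congr (U (_, weight _ * _)); apply/val_inj; rewrite /= nth_enum_ord.
  case=> i _ [m _]; case: insubP => // k' km k'k [[[[jg Mm] st] Si] Uk]; subst m.
  move: st Si Uk; rewrite /= /Y jg => st [Si Ai] Uk.
  rewrite /desc jg /descendants.
  have -> : hitting_time (A `|` S) (fun i => Z r j i w) = Some i.
    apply/first_indexP; split; first by right.
    by move=> n ni; exact: (st n ni).
  rewrite asboolF// size_map size_enum_ord; split=> //.
  rewrite (nth_map k') ?size_enum_ord//.
  move: Uk; congr (U (_, weight _ * _)); apply/val_inj.
  by rewrite /= nth_enum_ord.
have -> : gen r.+1 = fun w => flatten [seq desc j w | j <- iota 0 (size (gen r w))].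
  by apply/funext.
apply: (@seq_measurable_patch _ _ _ _ _ (fun w => size (gen r w))
   (fun n w => flatten [seq desc j w | j <- iota 0 n])).
  by move=> n; exact: seq_measurable_size mg.
by move=> n; exact: seq_measurable_flatten.
Qed.

End generation_measurable.

Lemma indic_measurable {R : realType} d (T : measurableType d) (E : set T) :
  measurable_fun setT (fun x => (\1_E x)%:E : \bar R) -> measurable E.
Proof.
move=> /(_ measurableT [set 1%E] (emeasurable_set1 1%E)); rewrite setTI => h.
suff -> : E = (fun x => (\1_E x)%:E : \bar R) @^-1` [set 1%E] by exact: h.
rewrite predeqE => x; rewrite /= indicE; split=> [Ex|].
  by rewrite mem_set.
by have [/set_mem//|_ /eqP] := boolP (x \in E); rewrite eqe eq_sym oner_eq0.
Qed.

Lemma emeasurable_prod {R : realType} d (T : measurableType d) I (s : seq I)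
    (f : I -> T -> \bar R) : (forall i, measurable_fun setT (f i)) ->
  measurable_fun setT (fun x => (\prod_(i <- s) f i x)%E).
Proof.
move=> mf; elim: s => [|i s ih]; first by under eq_fun do rewrite big_nil; exact: measurable_cst.
by under eq_fun do rewrite big_cons; exact: emeasurable_funM.
Qed.

(** * Conditional law of the offspring of a generation *)

Section run.
Context {R : realType} {d J : nat} {D : set 'rV[R]_d} {X : markov_chain D}
  {mech : splitting_mechanism R J} {A : set 'rV[R]_d} {C : nat -> set 'rV[R]_d}
  {l : nat} {x : 'rV[R]_d}.
Variable S : splitting_run X mech A C l x.
Hypotheses (mA : measurable A) (mC : forall j, measurable (C j)) (Dx : D x).

Local Notation Z := (@run_path _ _ _ _ _ _ _ _ _ _ S).
Local Notation M := (@run_mark _ _ _ _ _ _ _ _ _ _ S).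
Local Notation gen := (generation mech A C l x Z M).
Local Notation P := (run_prob S).

(** The generators of [splitting_history], named so that [g_sigma_algebraType] turns the history
    into a measurable space. *)
Definition history_generators r : set (set (run_space S)) :=
  [set F | exists r' j i U, [/\ (r' < r)%N, measurable U &
     F = [set w | (j < size (gen r' w))%N /\ U (Z r' j i w)]]]
  `|` [set F | exists r' j m, (r' < r)%N /\
     F = [set w | (j < size (gen r' w))%N /\ M r' j w = m]].

Lemma run_path_preimage r j i U : measurable U -> measurable (Z r j i @^-1` U).
Proof.
by move=> mU; have := @run_path_measurable _ _ _ _ _ _ _ _ _ _ S r j i measurableT _ mU; rewrite setTI.
Qed.

Lemma generation_measurable r : seq_measurable (x, 1 : R) (gen r).
Proof.
elim: r => [|r mg]; first exact: seq_measurable_cst.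
apply: generation_step_measurable => // [j i U mU|j m].
  rewrite (_ : mkset _ = [set w | (j < size (gen r w))%N] `&` Z r j i @^-1` U)//.
  apply: measurableI; first exact: (seq_measurable_size_gt j mg).
  exact: run_path_preimage.
rewrite (_ : mkset _ = [set w | (j < size (gen r w))%N] `&` M r j @^-1` [set m])//.
apply: measurableI; first exact: (seq_measurable_size_gt j mg).
exact: run_mark_measurable.
Qed.

(** In the history sigma-algebra the events on earlier existing particles are generators, so
    [generation_step_measurable] applies to it directly. *)
Lemma generation_history r r' : (r' <= r)%N ->
  @seq_measurable _ (g_sigma_algebraType (history_generators r)) _ _
    (x, 1 : R) (gen r').
Proof.
elim: r' => [_|r' ih lr]; first exact: seq_measurable_cst.
apply: (@generation_step_measurable _ _ _ _ _ _ _ _ _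
  (g_sigma_algebraType (history_generators r))) => // [|j i U mU|j m].
- by apply: ih; exact: ltnW.
- by apply: sub_sigma_algebra; left; exists r', j, i, U.
- by apply: sub_sigma_algebra; right; exists r', j, m.
Qed.

Lemma history_measurable r F : <<s history_generators r >> F -> measurable F.
Proof.
apply: smallest_sub; first exact: sigma_algebra_measurable.
move=> _ [[r' [j [i [U [_ mU ->]]]]]|[r' [j [m [_ ->]]]]].
  rewrite (_ : mkset _ = [set w | (j < size (gen r' w))%N] `&` Z r' j i @^-1` U)//.
  apply: measurableI; first exact: (seq_measurable_size_gt j (generation_measurable r')).
  exact: run_path_preimage.
rewrite (_ : mkset _ = [set w | (j < size (gen r' w))%N] `&` M r' j @^-1` [set m])//.
apply: measurableI; first exact: (seq_measurable_size_gt j (generation_measurable r')).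
exact: run_mark_measurable.
Qed.

Lemma generation_in r w p : p \in gen r w -> D p.1.
Proof.
case: r => [|r] /=; first by rewrite inE => /eqP ->.
move=> /flattenP[s /mapP[j _ ->]]; rewrite /descendants.
case: hitting_time => // i; case: ifP => // _ /mapP[k _ ->] /=.
exact: run_path_in.
Qed.

Lemma nth_generation_in r w j : D (nth (x, 1) (gen r w) j).1.
Proof.
have [jg|jg] := ltnP j (size (gen r w)); last by rewrite nth_default.
by apply: generation_in; exact: mem_nth.
Qed.

Lemma generation_weight_ge0 r w p : p \in gen r w -> 0 <= p.2.
Proof.
elim: r p => [|r ih] p /=; first by rewrite inE => /eqP ->.
move=> /flattenP[s /mapP[j + ->]]; rewrite mem_iota add0n /= => jg.
rewrite /descendants; case: hitting_time => // i; case: ifP => // _ /mapP[k _ ->] /=.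
by rewrite mulr_ge0// ?weight_ge0// ih// mem_nth.
Qed.

Local Open Scope ereal_scope.

(* [((k, U), m, q)] stands for the event that the path is in [U i] at each time
   [i < k] and that the splitting variable is [m]; [q y] is the probability of
   the path event for the chain started at [y]. *)
Definition coord_data : Type := nat * (nat -> set 'rV[R]_d) * 'I_J * ('rV[R]_d -> \bar R).
Implicit Type c : coord_data.

Definition coord_ok c := [/\ forall i, measurable (c.1.1.2 i),
  measurable_fun setT c.2, forall y, 0 <= c.2 y &
  forall y, D y -> chain_law X y [set v | forall i, (i < c.1.1.1)%N -> c.1.1.2 i (chain X i v)] = c.2 y].

Definition coord_fun c (z : nat -> 'rV[R]_d) (m : 'I_J) : \bar R :=
  (\1_[set z | forall i, (i < c.1.1.1)%N -> c.1.1.2 i (z i)] z)%:E *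
  (\1_[set c.1.2] m)%:E.

Definition coord_mean c y := c.2 y * (mech_law mech c.1.2)%:E.

(* [linked f F]: [f] is a functional of a path and a splitting variable, and
   [F y] its mean when the path is the chain started at [y]. *)
Inductive linked : ((nat -> 'rV[R]_d) -> 'I_J -> \bar R) -> ('rV[R]_d -> \bar R) -> Prop :=
| linked_coord c : coord_ok c -> linked (coord_fun c) (coord_mean c)
| linkedZ (k : R) f F : (0 <= k)%R -> linked f F ->
    linked (fun z m => k%:E * f z m) (fun y => k%:E * F y)
| linked_series f_ F_ : (forall n, linked (f_ n) (F_ n)) ->
    linked (fun z m => \sum_(n <oo) f_ n z m) (fun y => \sum_(n <oo) F_ n y).

Lemma coord_fun_ge0 c z m : 0 <= coord_fun c z m.
Proof. by rewrite mule_ge0// lee_fin. Qed.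

Lemma linked_ge0 f F : linked f F -> (forall z m, 0 <= f z m) /\ (forall y, 0 <= F y).
Proof.
elim=> [c [_ _ c0 _]|k {}f {}F k0 _ [f0 F0]|f_ F_ _ ih].
- split=> [z m|y]; first exact: coord_fun_ge0.
  by rewrite mule_ge0// lee_fin mech_law_ge0.
- by split=> *; rewrite mule_ge0.
- by split=> *; apply: nneseries_ge0 => n _ _; [apply: (ih n).1|apply: (ih n).2].
Qed.

Lemma linked_measurable f F : linked f F -> measurable_fun setT F.
Proof.
elim=> [c [_ mc _ _]|k {}f {}F k0 _ mF|f_ F_ fF mF].
- rewrite (_ : coord_mean c = fun y => (mech_law mech c.1.2)%:E * c.2 y).
    exact: measurable_funeM.
  by apply/funext => y; rewrite muleC.
- exact: measurable_funeM.
- apply: (@ge0_emeasurable_sum _ _ _ setT F_ xpredT) => // n y _ _.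
  exact: (linked_ge0 (fF n)).2.
Qed.

Lemma linked_run_measurable r j f F : linked f F ->
  measurable_fun setT (fun w => f (fun i => Z r j i w) (M r j w)).
Proof.
elim=> [c [mU _ _ _]|k {}f {}F k0 _ mf|f_ F_ fF mf].
- apply: emeasurable_funM; apply/measurable_EFinP.
    have -> : (fun w => \1_[set z | forall i, (i < c.1.1.1)%N -> c.1.1.2 i (z i)] (fun i => Z r j i w)) =
      (\1_[set w | forall i, (i < c.1.1.1)%N -> c.1.1.2 i (Z r j i w)] : _ -> R).
      by apply/funext => w; rewrite (indic_preimage (fun w i => Z r j i w)).
    apply: measurable_indic.
    rewrite (_ : mkset _ = \bigcap_(i in [set i | (i < c.1.1.1)%N]) (Z r j i @^-1` c.1.1.2 i))//.
    by apply: bigcap_measurableType => i _; exact: run_path_preimage.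
  have -> : (fun w => \1_[set c.1.2] (M r j w)) = (\1_[set w | M r j w = c.1.2] : _ -> R).
    by apply/funext => w; rewrite indic_preimage.
  apply: measurable_indic; exact: run_mark_measurable.
- exact: measurable_funeM.
- apply: (@ge0_emeasurable_sum _ _ _ setT
    (fun n w => f_ n (fun i => Z r j i w) (M r j w)) xpredT) => // n y _ _.
  exact: (linked_ge0 (fF n)).1.
Qed.

Section run_law.
Variables (r N : nat) (h : run_space S -> \bar R).
Hypotheses (rl : (r < l)%N)
  (mh : @measurable_fun _ _ (g_sigma_algebraType (history_generators r)) _ setT h)
  (h0 : forall w, 0 <= h w).

Let pos j w := (nth (x, 1%R) (gen r w) j).1.
Let sizeN := [set w | size (gen r w) = N].
Let path_at j w : nat -> 'rV[R]_d := fun i => Z r j i w.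

Let msizeN : measurable sizeN.
Proof. exact: (seq_measurable_size N (generation_measurable r)). Qed.

Let mpos j : measurable_fun setT (pos j).
Proof.
apply: (measurableT_comp (f := fst)) => //.
exact: (seq_measurable_nth j (generation_measurable r)).
Qed.

Lemma history_measurable_fun (h' : run_space S -> \bar R) :
  @measurable_fun _ _ (g_sigma_algebraType (history_generators r)) _ setT h' ->
  measurable_fun [set: run_space S] h'.
Proof.
move=> mh' _ U mU; rewrite setTI.
by apply: (@history_measurable r); have := mh' measurableT U mU; rewrite setTI.
Qed.

(** Extends [run_law] in two ways: the cylinders may have different lengths, and the history event
    becomes a nonnegative history-measurable factor [h], by [nnfun_ind]. *)
Let run_law_coord (c : nat -> coord_data) : (forall j, coord_ok (c j)) ->
  \int[P]_w ((\1_sizeN w)%:E * h w * \prod_(j < N) coord_fun (c j) (path_at j w) (M r j w)) =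
  \int[P]_w ((\1_sizeN w)%:E * h w * \prod_(j < N) coord_mean (c j) (pos j w)).
Proof.
move=> cok.
(* Common length of the cylinders; shorter ones are padded with the full set. *)
pose K := (\max_(j < N) (c j).1.1.1)%N.
pose U j i := if (i < (c j).1.1.1)%N then (c j).1.1.2 i else setT.
have cylE j (z : nat -> 'rV[R]_d) : (j < N)%N -> (forall i, (i < K)%N -> U j i (z i)) <->
    (forall i, (i < (c j).1.1.1)%N -> (c j).1.1.2 i (z i)).
  move=> jN; split=> Uz i ik; last by rewrite /U; case: ifP => // ci; exact: Uz.
  have := Uz i; rewrite /U ik; apply.
  exact: leq_trans ik (leq_bigmax (Ordinal jN)).
have mU j i : measurable (U j i) by rewrite /U; case: ifP => // _; case: (cok j).
pose cf j w := coord_fun (c j) (path_at j w) (M r j w).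
have mcf j : measurable_fun setT (cf j).
  exact: (linked_run_measurable r j (linked_coord (cok j))).
have cf0 w : 0 <= \prod_(j < N) cf j w by apply: prode_ge0 => j _; exact: coord_fun_ge0.
have cm0 w : 0 <= \prod_(j < N) coord_mean (c j) (pos j w).
  by apply: prode_ge0 => j _; exact: (linked_ge0 (linked_coord (cok j))).2.
have mcm : measurable_fun setT (fun w => \prod_(j < N) coord_mean (c j) (pos j w)).
  apply: emeasurable_prod => j.
  by apply: measurableT_comp => //; exact: (linked_measurable (linked_coord (cok j))).
have m1 : measurable_fun setT (fun w => (\1_sizeN w)%:E : \bar R) by exact/measurable_EFinP.
pose Q (g : run_space S -> \bar R) :=
  \int[P]_w ((\1_sizeN w)%:E * g w * \prod_(j < N) cf j w) =
  \int[P]_w ((\1_sizeN w)%:E * g w * \prod_(j < N) coord_mean (c j) (pos j w)).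
have mI (g k : run_space S -> \bar R) :
    @measurable_fun _ _ (g_sigma_algebraType (history_generators r)) _ setT g ->
    measurable_fun setT k ->
    measurable_fun setT (fun w => (\1_sizeN w)%:E * g w * k w).
  move=> mg mk.
  have mg' : measurable_fun [set: run_space S] (g : _ -> \bar R) by exact: history_measurable_fun.
  by apply: emeasurable_funM => //; exact: emeasurable_funM.
apply: (@nnfun_ind R _ (g_sigma_algebraType (history_generators r)) Q) => //; rewrite /Q.
- move=> F mF; pose E : set (run_space S) := [set w | [/\ F w, size (gen r w) = N &
    forall j, (j < N)%N -> (forall i, (i < K)%N -> U j i (Z r j i w)) /\
       M r j w = (c j).1.2]].
  have EE w : (\1_sizeN w)%:E * (\1_F w)%:E * \prod_(j < N) cf j w = (\1_E w)%:E.
    have [Ew|Ew] := pselect (E w).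
      have [Fw sw cw] := Ew.
      rewrite !indicE (mem_set Ew) (mem_set Fw) (@mem_set _ sizeN)// !mul1e.
      apply: big1 => j _; have [cj mj] := cw j (ltn_ord j).
      rewrite /cf /coord_fun !indicE !mem_set ?mul1e//.
      by apply/(cylE j _ (ltn_ord j)).
    rewrite [in RHS]indicE memNset//.
    have [Fw|Fw] := pselect (F w); last by rewrite (indicE _ F) memNset// mule0 mul0e.
    have [sw|sw] := pselect (sizeN w); last by rewrite (indicE _ sizeN) memNset// !mul0e.
    have [j jP] : exists j : 'I_N, ~ ((forall i, (i < K)%N -> U j i (Z r j i w)) /\
       M r j w = (c j).1.2).
      apply: contrapT => nj; apply: Ew; split=> // j jN.
      by apply: contrapT => h'; apply: nj; exists (Ordinal jN).
    rewrite (bigD1 j)//= [X in _ * (X * _)](_ : _ = 0) ?mul0e ?mule0//.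
    rewrite /cf /coord_fun !indicE.
    have [mj|mj] := pselect (M r j w = (c j).1.2); last first.
      have mjF : (M r j w \in [set (c j).1.2]) = false by apply: memNset.
      by rewrite mjF mule0.
    rewrite memNset ?mul0e// => /(cylE j _ (ltn_ord j)) cj; exact: jP.
  (* Read off the product formula [EE] for the indicator of [E]. *)
  have mE : measurable E.
    apply: (@indic_measurable R); under eq_fun do rewrite -EE.
    apply: mI; first exact/measurable_EFinP/measurable_indic.
    exact: emeasurable_prod.
  transitivity (P E).
    by rewrite -[in RHS](setIT E) -integral_indic//; apply: eq_integral => w _; rewrite EE.
  rewrite /E (run_law rl mF)// integral_indicl; apply: eq_integral => w _.
  congr (_ * _).
    by rewrite !indicE in_setI -EFinM -natrM mulnb andbC.
  apply: eq_bigr => j _; rewrite /coord_mean; congr (_ * _).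
  case: (cok j) => _ _ _ <-; last exact: nth_generation_in.
  by congr (chain_law _ _ _); apply/seteqP; split=> v /= /(cylE j _ (ltn_ord j)).
- move=> k g k0 mg g0 ih.
  have e u w : (\1_sizeN w)%:E * (k%:E * g w) * u = k%:E * ((\1_sizeN w)%:E * g w * u).
    by rewrite [_ * (k%:E * _)]muleCA -!muleA.
  under eq_integral do rewrite e.
  under [in RHS]eq_integral do rewrite e.
  rewrite !ge0_integralZl_EFin//; first by rewrite ih.
  + by move=> w _; rewrite !mule_ge0// lee_fin.
  + by apply: mI.
  + by move=> w _; rewrite !mule_ge0// lee_fin.
  + by apply: mI => //; exact: emeasurable_prod.
- move=> g mg g0 ih.
  have e (u : run_space S -> \bar R) w : 0 <= u w ->
     (\1_sizeN w)%:E * (\sum_(n <oo) g n w) * u w =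
     \sum_(n <oo) ((\1_sizeN w)%:E * g n w * u w).
    move=> u0; rewrite muleAC -nneseriesZle//; last by rewrite mule_ge0// lee_fin.
    by apply: eq_eseriesr => n _; rewrite muleAC.
  under eq_integral do rewrite (e (fun w => \prod_(j < N) cf j w))//.
  under [in RHS]eq_integral do rewrite (e (fun w => \prod_(j < N) coord_mean (c j) (pos j w)))//.
  rewrite !integral_nneseries//.
  + by apply: eq_eseriesr => n _; exact: ih.
  + by move=> n; apply: mI.
  + by move=> n w _; rewrite !mule_ge0// lee_fin.
  + by move=> n; apply: mI => //; exact: emeasurable_prod.
  + by move=> n w _; rewrite !mule_ge0// lee_fin.
Qed.

Let mh' : measurable_fun [set: run_space S] h.
Proof. exact: history_measurable_fun. Qed.

Let m1 : measurable_fun setT (fun w => (\1_sizeN w)%:E : \bar R).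
Proof. exact/measurable_EFinP. Qed.

(** As functions of the factor [t] alone, both sides are integrals against fixed nonnegative weights
    [k] and [k']; the equality therefore propagates along the constructors of [linked]. *)
Let run_law_exchange (t : 'I_N) (f : nat -> (nat -> 'rV[R]_d) -> 'I_J -> \bar R)
    (F : nat -> 'rV[R]_d -> \bar R) :
  (forall j, linked (f j) (F j)) ->
  (forall c, coord_ok c ->
    \int[P]_w ((\1_sizeN w)%:E * h w *
      \prod_(j < N) (if j == t then coord_fun c else f j) (path_at j w) (M r j w)) =
    \int[P]_w ((\1_sizeN w)%:E * h w *
      \prod_(j < N) (if j == t then coord_mean c else F j) (pos j w))) ->
  forall g G, linked g G ->
    \int[P]_w ((\1_sizeN w)%:E * h w *
      \prod_(j < N) (if j == t then g else f j) (path_at j w) (M r j w)) =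
    \int[P]_w ((\1_sizeN w)%:E * h w *
      \prod_(j < N) (if j == t then G else F j) (pos j w)).
Proof.
move=> fF Ec.
pose k w := (\1_sizeN w)%:E * h w * \prod_(j < N | j != t) f j (path_at j w) (M r j w).
pose k' w := (\1_sizeN w)%:E * h w * \prod_(j < N | j != t) F j (pos j w).
have kE g w : (\1_sizeN w)%:E * h w *
      \prod_(j < N) (if j == t then g else f j) (path_at j w) (M r j w) =
    k w * g (path_at t w) (M r t w).
  rewrite (bigD1 t)//= eqxx muleCA muleC; congr (_ * _ * _).
  by apply: eq_bigr => j /negbTE ->.
have kE' G w : (\1_sizeN w)%:E * h w *
      \prod_(j < N) (if j == t then G else F j) (pos j w) = k' w * G (pos t w).
  rewrite (bigD1 t)//= eqxx muleCA muleC; congr (_ * _ * _).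
  by apply: eq_bigr => j /negbTE ->.
have k0 w : 0 <= k w.
  rewrite !mule_ge0// ?lee_fin//; apply: prode_ge0 => j _.
  exact: (linked_ge0 (fF j)).1.
have k'0 w : 0 <= k' w.
  rewrite !mule_ge0// ?lee_fin//; apply: prode_ge0 => j _.
  exact: (linked_ge0 (fF j)).2.
have mk : measurable_fun setT k.
  apply: emeasurable_funM; first exact: emeasurable_funM.
  under eq_fun do rewrite big_mkcond.
  apply: emeasurable_prod => j; case: (j != t) => //.
  exact: (linked_run_measurable r j (fF j)).
have mk' : measurable_fun setT k'.
  apply: emeasurable_funM; first exact: emeasurable_funM.
  under eq_fun do rewrite big_mkcond.
  apply: emeasurable_prod => j; case: (j != t) => //.
  by apply: measurableT_comp => //; exact: (linked_measurable (fF j)).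
move=> g G gG; under eq_integral do rewrite kE.
under [in RHS]eq_integral do rewrite kE'.
elim: gG => [c cok|a {}g {}G a0 gG ih|g_ G_ gG ih].
- under eq_integral do rewrite -kE.
  under [in RHS]eq_integral do rewrite -kE'.
  exact: Ec.
- under eq_integral do rewrite muleCA.
  under [in RHS]eq_integral do rewrite muleCA.
  rewrite !ge0_integralZl_EFin//; first by rewrite ih.
  + by move=> w _; apply: mule_ge0 => //; exact: (linked_ge0 gG).2.
  + by apply: emeasurable_funM => //; apply: measurableT_comp => //; exact: linked_measurable gG.
  + by move=> w _; apply: mule_ge0 => //; exact: (linked_ge0 gG).1.
  + by apply: emeasurable_funM => //; exact: linked_run_measurable gG.
- have g0 n z m := (linked_ge0 (gG n)).1 z m.
  have G0 n y := (linked_ge0 (gG n)).2 y.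
  under eq_integral do rewrite -nneseriesZle//.
  under [in RHS]eq_integral do rewrite -nneseriesZle//.
  rewrite !integral_nneseries//.
  + by apply: eq_eseriesr => n _; exact: ih.
  + move=> n; apply: emeasurable_funM => //.
    by apply: measurableT_comp => //; exact: linked_measurable (gG n).
  + by move=> n w _; apply: mule_ge0 => //; exact: (linked_ge0 (gG n)).2.
  + by move=> n; apply: emeasurable_funM => //; exact: linked_run_measurable (gG n).
  + by move=> n w _; apply: mule_ge0 => //; exact: (linked_ge0 (gG n)).1.
Qed.

(* The cylinder functionals of [run_law_coord] are replaced by arbitrary linked
   ones particle by particle. *)
Lemma run_law_linked (f : nat -> (nat -> 'rV[R]_d) -> 'I_J -> \bar R)
    (F : nat -> 'rV[R]_d -> \bar R) :
  (forall j, linked (f j) (F j)) ->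
  \int[P]_w ((\1_sizeN w)%:E * h w * \prod_(j < N) f j (path_at j w) (M r j w)) =
  \int[P]_w ((\1_sizeN w)%:E * h w * \prod_(j < N) F j (pos j w)).
Proof.
move=> fF.
(* The trivial coordinate. Evaluating a mark at [point] provides an inhabitant of ['I_J]. *)
pose c0 : coord_data := (0%N, fun=> setT, M 0 0 point, cst 1).
have c0ok : coord_ok c0.
  split=> //= y Dy; rewrite (_ : mkset _ = setT) ?probability_setT//.
  by apply/seteqP; split.
suff claim t : (t <= N)%N -> forall b : nat -> coord_data, (forall j, coord_ok (b j)) ->
    \int[P]_w ((\1_sizeN w)%:E * h w *
      \prod_(j < N) (if (j < t)%N then f j else coord_fun (b j)) (path_at j w) (M r j w)) =
    \int[P]_w ((\1_sizeN w)%:E * h w *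
      \prod_(j < N) (if (j < t)%N then F j else coord_mean (b j)) (pos j w)).
  have := claim N (leqnn N) (fun=> c0) (fun=> c0ok).
  under eq_integral do under eq_bigr do rewrite ltn_ord.
  by under [in RHS]eq_integral do under eq_bigr do rewrite ltn_ord.
elim: t => [_ b bok|t ih tN b bok]; first exact: run_law_coord.
pose f' j := if (j < t)%N then f j else coord_fun (b j).
pose F' j := if (j < t)%N then F j else coord_mean (b j).
have fF' j : linked (f' j) (F' j).
  by rewrite /f' /F'; case: ifP => // _; exact: linked_coord.
have E1 w : \prod_(j < N) (if (j < t.+1)%N then f j else coord_fun (b j)) (path_at j w) (M r j w) =
    \prod_(j < N) (if j == Ordinal tN then f t else f' j) (path_at j w) (M r j w).
  by apply: eq_bigr => j _; rewrite /f' -(inj_eq val_inj)/= ltnS; case: (ltngtP j t) => // ->.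
have E2 w : \prod_(j < N) (if (j < t.+1)%N then F j else coord_mean (b j)) (pos j w) =
    \prod_(j < N) (if j == Ordinal tN then F t else F' j) (pos j w).
  by apply: eq_bigr => j _; rewrite /F' -(inj_eq val_inj)/= ltnS; case: (ltngtP j t) => // ->.
under eq_integral do rewrite E1.
under [in RHS]eq_integral do rewrite E2.
apply: (@run_law_exchange (Ordinal tN) f' F' fF' _ (f t) (F t) (fF t)) => c cok.
pose b' j := if j == t then c else b j.
have E3 w : \prod_(j < N) (if j == Ordinal tN then coord_fun c else f' j) (path_at j w) (M r j w) =
    \prod_(j < N) (if (j < t)%N then f j else coord_fun (b' j)) (path_at j w) (M r j w).
  by apply: eq_bigr => j _; rewrite /f' /b' -(inj_eq val_inj)/=; case: (ltngtP j t) => // ->.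
have E4 w : \prod_(j < N) (if j == Ordinal tN then coord_mean c else F' j) (pos j w) =
    \prod_(j < N) (if (j < t)%N then F j else coord_mean (b' j)) (pos j w).
  by apply: eq_bigr => j _; rewrite /F' /b' -(inj_eq val_inj)/=; case: (ltngtP j t) => // ->.
under eq_integral do rewrite E3.
under [in RHS]eq_integral do rewrite E4.
by apply: (ih (ltnW tN) b') => j; rewrite /b'; case: ifP.
Qed.

End run_law.
End run.

(** * Path and mark functionals with explicit mean *)

Section kill_linear.
Local Open Scope ereal_scope.
Context {R : realType} {d} {T : measurableType d} (K : R.-pker T ~> T).
Variable N : set T.
Hypothesis mN : measurable N.
Implicit Types f : T -> \bar R.

Lemma iter_killZ i (k : R) f y : (0 <= k)%R -> (forall z, 0 <= f z) ->
  measurable_fun setT f ->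
  iter i (kill K N) (fun z => k%:E * f z) y = k%:E * iter i (kill K N) f y.
Proof.
move=> k0 f0 mf; elim: i y => //= i ih y; rewrite /kill.
under eq_integral do rewrite ih.
rewrite ge0_integralZl_EFin//; first by rewrite muleCA.
- by move=> z _; exact: iter_kill_ge0.
- exact: measurable_iter_kill.
Qed.

Lemma iter_kill_series i (f_ : nat -> T -> \bar R) y : (forall n z, 0 <= f_ n z) ->
  (forall n, measurable_fun setT (f_ n)) ->
  iter i (kill K N) (fun z => \sum_(n <oo) f_ n z) y = \sum_(n <oo) iter i (kill K N) (f_ n) y.
Proof.
move=> f0 mf; elim: i y => //= i ih y; rewrite {1}/kill.
under eq_integral do rewrite ih.
rewrite integral_nneseries//; last 2 first.
- by move=> n; exact: measurable_iter_kill.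
- by move=> n z _; exact: iter_kill_ge0.
by rewrite -nneseriesZle// => n; apply: integral_ge0 => z _; exact: iter_kill_ge0.
Qed.

End kill_linear.

Section linked_functionals.
Local Open Scope ereal_scope.
Context {R : realType} {d J : nat} {D : set 'rV[R]_d} {X : markov_chain D}
  {mech : splitting_mechanism R J}.
Implicit Types (f : (nat -> 'rV[R]_d) -> 'I_J -> \bar R) (F : 'rV[R]_d -> \bar R).
Local Notation linked := (@linked R d J D X mech).

Lemma eq_linked f f' F F' : (forall z m, f z m = f' z m) -> (forall y, F y = F' y) ->
  linked f F -> linked f' F'.
Proof.
move=> ff FF; have -> : f' = f by apply/funext => z; apply/funext.
by have -> : F' = F by apply/funext.
Qed.

(** A series with two terms; its tail [0 * f] is linked by scaling. *)
Lemma linkedD f f' F F' : linked f F -> linked f' F' ->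
  linked (fun z m => f z m + f' z m) (fun y => F y + F' y).
Proof.
move=> fF fF'; have [f0 F0] := linked_ge0 fF; have [f'0 F'0] := linked_ge0 fF'.
apply: (@eq_linked
  (fun z m => \sum_(i <oo)
    (if i is j.+1 then if j is _.+1 then (fun z m => 0%R%:E * f z m) else f' else f) z m) _
  (fun y => \sum_(i <oo)
    (if i is j.+1 then if j is _.+1 then (fun y => 0%R%:E * F y) else F' else F) y)).
- move=> z m; rewrite -nneseries_add0//.
  by apply: eq_eseriesr => -[|[|n]] //= _; rewrite mul0e.
- move=> y; rewrite -nneseries_add0//.
  by apply: eq_eseriesr => -[|[|n]] //= _; rewrite mul0e.
- by apply: linked_series => -[|[|n]] //; exact: linkedZ.
Qed.

Lemma linked_sum (I : eqType) (s : seq I)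
    (f_ : I -> (nat -> 'rV[R]_d) -> 'I_J -> \bar R) (F_ : I -> 'rV[R]_d -> \bar R) : s != [::] ->
  (forall i, linked (f_ i) (F_ i)) ->
  linked (fun z m => \sum_(i <- s) f_ i z m) (fun y => \sum_(i <- s) F_ i y).
Proof.
case: s => // i s _ fF; elim: s i => [|j s ih] i.
  by apply: eq_linked (fF i) => *; rewrite big_seq1.
by apply: eq_linked (linkedD (fF i) (ih j)) => *; rewrite [RHS]big_cons.
Qed.

(** Expands [phi] over the values of the mark; the coefficients [mech_law] assemble into
    [mech_E]. *)
Lemma linked_mark (g : (nat -> 'rV[R]_d) -> \bar R) G (phi : 'I_J -> R) :
  (forall m, 0 <= phi m)%R ->
  (forall m, linked (fun z m' => g z * (\1_[set m] m')%:E) (fun y => G y * (mech_law mech m)%:E)) ->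
  (forall z, 0 <= g z) -> (forall y, 0 <= G y) ->
  linked (fun z m => (phi m)%:E * g z) (fun y => (mech_E mech phi)%:E * G y).
Proof.
move=> phi0 gG g0 G0.
(* There is at least one mark, because the mark law has total mass 1. *)
have sJ : index_enum 'I_J != [::].
  apply/eqP => e; have := mech_law_sum1 mech.
  rewrite /index_enum; move: e; rewrite /index_enum => ->.
  by rewrite big_nil => /eqP; rewrite eq_sym oner_eq0.
apply: eq_linked (linked_sum sJ (fun m => linkedZ (phi0 m) (gG m))) => [z m|y].
  rewrite (bigD1 m)//= big1 ?adde0; last first.
    by move=> m' mm'; rewrite indicE memNset ?mule0// => e; move: mm'; rewrite e eqxx.
  by rewrite indicE mem_set// mule1.
rewrite /mech_E -sumEFin ge0_sume_distrl; last first.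
  by move=> m _; rewrite lee_fin mulr_ge0// mech_law_ge0.
by apply: eq_bigr => m _; rewrite EFinM [LHS]muleC [RHS]muleC [RHS]muleA.
Qed.

(** The factor given to the particles that do not enter a one-particle or two-particle integral. *)
Lemma linked1 : linked (fun _ _ => 1) (fun=> 1).
Proof.
have h (m : 'I_J) : linked (fun z m' => 1 * (\1_[set m] m')%:E) (fun y => 1 * (mech_law mech m)%:E).
  pose c : @coord_data R d J := (0%N, fun=> setT, m, cst 1).
  have cok : @coord_ok R d J D X c.
    split=> //= y Dy; rewrite (_ : mkset _ = setT) ?probability_setT//.
    by apply/seteqP; split.
  apply: eq_linked (linked_coord (mech := mech) cok) => // z m'.
  by rewrite /coord_fun indicE mem_set.
apply: eq_linked (linked_mark (fun _ => ler01) h _ _) => //.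
- by move=> *; rewrite mul1e.
- move=> y; rewrite mule1 /mech_E; under eq_bigr do rewrite mulr1.
  by rewrite mech_law_sum1.
Qed.

Variables A S : set 'rV[R]_d.
Hypotheses (mA : measurable A) (mS : measurable S).
Local Notation N := (~` (A `|` S)).

Let mN : measurable N. Proof. by apply: measurableC; exact: measurableU. Qed.

(** For an indicator [g] this is a coordinate functional of length [i.+1], with [N] at the first [i]
    times and [U] at time [i]; [nnfun_ind] does the rest. *)
Lemma linked_stays i (m : 'I_J) (g : 'rV[R]_d -> \bar R) :
  measurable_fun setT g -> (forall z, 0 <= g z) ->
  linked (fun z m' => (\1_(stays N i) z)%:E * g (z i) * (\1_[set m] m')%:E)
    (fun y => iter i (kill (chain_ker X) N) g y * (mech_law mech m)%:E).
Proof.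
move: g; apply: nnfun_ind.
- move=> U mU.
  pose V k := if (k < i)%N then N else U.
  pose c : @coord_data R d J := (i.+1, V, m, iter i (kill (chain_ker X) N) (fun z => (\1_U z)%:E)).
  have VE (z : nat -> 'rV[R]_d) :
      (forall k, (k < i.+1)%N -> V k (z k)) <-> stays N i z /\ U (z i).
    rewrite /V; split=> [h|[Nz Ui] k].
      split=> [k ki|]; first by have := h k (ltnW ki); rewrite ki.
      by have := h i (ltnSn i); rewrite ltnn.
    by rewrite ltnS leq_eqVlt => /orP[/eqP ->|ki]; rewrite ?ltnn// ki; exact: Nz.
  have cE z : (\1_[set z | forall k, (k < i.+1)%N -> V k (z k)] z)%:E =
      (\1_(stays N i) z)%:E * (\1_U (z i))%:E :> \bar R.
    rewrite -EFinM; congr EFin; rewrite !indicE -natrM mulnb; congr (nat_of_bool _)%:R.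
    by apply/idP/andP; rewrite !inE => /VE.
  have mind : measurable_fun setT (fun z => (\1_U z)%:E : \bar R) by exact/measurable_EFinP.
  have cok : @coord_ok R d J D X c.
    split=> //=.
    - by move=> k; rewrite /V; case: ifP.
    - exact: measurable_iter_kill.
    - by move=> y; apply: iter_kill_ge0 => z; rewrite lee_fin.
    move=> y Dy; rewrite -chain_stays//.
    set E := mkset _.
    have EE v : (\1_E v)%:E = (\1_(stays N i) (path_of v))%:E * (\1_U (chain X i v))%:E :> \bar R.
      by rewrite -[chain X i v]/(path_of v i) -cE indic_preimage.
    under eq_integral do rewrite -EE.
    rewrite integral_indic ?setIT//.
    rewrite /E (_ : mkset _ = \bigcap_(k in [set k | (k < i.+1)%N]) (chain X k @^-1` V k))//.
    apply: bigcap_measurableType => k _; apply: measurable_chain_preimage.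
    by rewrite /V; case: ifP.
  by apply: eq_linked (linked_coord (mech := mech) cok) => // z m'; rewrite -cE.
- move=> k g k0 mg g0 ih; apply: eq_linked (linkedZ k0 ih) => [z m'|y].
    by rewrite [in RHS](muleCA _ k%:E) -[RHS]muleA.
  by rewrite iter_killZ// muleA.
- move=> g mg g0 ih; apply: eq_linked (linked_series ih) => [z m'|y].
    rewrite -nneseriesZle//.
    rewrite [RHS]muleC -nneseriesZle//; last first.
      by move=> n; rewrite mule_ge0// lee_fin.
    by apply: eq_eseriesr => n _; rewrite muleC.
  rewrite iter_kill_series// [RHS]muleC -nneseriesZle//; last 2 first.
  + by rewrite lee_fin mech_law_ge0.
  + by move=> n; exact: iter_kill_ge0.
  by apply: eq_eseriesr => n _; rewrite muleC.
Qed.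

(** The hitting time is unbounded, so [hitval] is no cylinder functional, but [hitval_series] makes
    it a countable sum of linked ones. *)
Lemma linked_hitval (phi : 'I_J -> R) (g : 'rV[R]_d -> \bar R) :
  (forall m, 0 <= phi m)%R -> measurable_fun setT g -> (forall z, 0 <= g z) ->
  linked (fun z m => (phi m)%:E * hitval A S g z)
    (fun y => (mech_E mech phi)%:E * pot (chain_ker X) A S g y).
Proof.
move=> phi0 mg g0; apply: linked_mark => //.
- move=> m.
  have m1 : measurable_fun setT (fun z => (\1_(S `\` A) z)%:E * g z).
    by apply: emeasurable_funM => //; apply/measurable_EFinP/measurable_indic; exact: measurableD.
  have p1 z : 0 <= (\1_(S `\` A) z)%:E * g z by rewrite mule_ge0// lee_fin.
  apply: eq_linked (linked_series (fun i => linked_stays i m m1 p1)) => [z m'|y].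
    rewrite hitval_series// [RHS]muleC -nneseriesZle//; last first.
      by move=> n; rewrite mule_ge0// lee_fin.
    by apply: eq_eseriesr => n _; rewrite muleC.
  rewrite /pot [RHS]muleC -nneseriesZle//; last 2 first.
  + by rewrite lee_fin mech_law_ge0.
  + by move=> n; exact: iter_kill_ge0.
  by apply: eq_eseriesr => n _; rewrite muleC.
- by move=> z; exact: hitval_ge0.
- by move=> y; exact: pot_ge0.
Qed.

End linked_functionals.

Lemma eq_pot {R : realType} {d} {T : measurableType d} (K : R.-pker T ~> T)
    (A S : set T) (f g : T -> \bar R) y :
  (forall z, (S `\` A) z -> f z = g z) -> pot K A S f y = pot K A S g y.
Proof.
move=> fg; rewrite /pot /potn.
suff -> : (fun z => ((\1_(S `\` A) z)%:E * f z)%E) = (fun z => ((\1_(S `\` A) z)%:E * g z)%E) by [].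
apply/funext => z; have [Sz|Sz] := pselect ((S `\` A) z); first by rewrite fg.
by rewrite indicE memNset ?mul0e.
Qed.

Lemma sqre_sum_pairs {R : realType} n (a : 'I_n -> \bar R) : (forall i, 0 <= a i)%E ->
  ((\sum_i a i) ^+ 2 = \sum_(p : 'I_n * 'I_n) a p.1 * a p.2)%E.
Proof.
move=> a0; rewrite expe2 ge0_sume_distrl//.
under eq_bigr do rewrite ge0_sume_distrr//.
exact: (pair_bigA _ (fun i j => (a i * a j)%E)).
Qed.

(** * First and second moments of the sample *)

Section moments.
Local Open Scope ereal_scope.
Context {R : realType} {d J : nat} {D : set 'rV[R]_d} {X : markov_chain D}
  {mech : splitting_mechanism R J} {A : set 'rV[R]_d} {C : nat -> set 'rV[R]_d}
  {l : nat} {x : 'rV[R]_d}.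
Variable S : splitting_run X mech A C l x.
Hypotheses (mA : measurable A) (mC : forall j, measurable (C j)) (Dx : D x).

Local Notation Z := (@run_path _ _ _ _ _ _ _ _ _ _ S).
Local Notation M := (@run_mark _ _ _ _ _ _ _ _ _ _ S).
Local Notation gen := (generation mech A C l x Z M).
Local Notation P := (run_prob S).
Local Notation pot := (pot (chain_ker X) A).
Implicit Types (e r N : nat) (g : 'rV[R]_d -> \bar R).

Definition weight_sum e (m : 'I_J) : R := (\sum_(k < offspring mech m) weight k ^+ e)%R.

(** The exponent [e] is 1 for the weighted sum itself and 2 for the sums of squared weights that
    come from the diagonal of its square. *)
Definition gen_sum e r g w := \sum_(p <- gen r w) (p.2 ^+ e)%:E * g p.1.

Let om j r w : R := (nth (x, 1%R) (gen r w) j).2.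
Let pos j r w := (nth (x, 1%R) (gen r w) j).1.
Let path_at r j w : nat -> 'rV[R]_d := fun i => Z r j i w.
Let sizeN r N := [set w | size (gen r w) = N].

Lemma weight_sum_ge0 e m : (0 <= weight_sum e m)%R.
Proof. by apply: sumr_ge0 => k _; rewrite exprn_ge0// weight_ge0. Qed.

Let om_ge0 j r w : (0 <= om j r w)%R.
Proof.
rewrite /om; have [jg|jg] := ltnP j (size (gen r w)); last by rewrite nth_default.
by apply: (@generation_weight_ge0 _ _ _ _ _ _ _ _ _ _ S r w); exact: mem_nth.
Qed.

Lemma gen_sum_ge0 e r g w : (forall y, 0 <= g y) -> 0 <= gen_sum e r g w.
Proof.
move=> g0; rewrite /gen_sum big_seq; apply: sume_ge0 => p pg.
by rewrite mule_ge0// lee_fin exprn_ge0//; exact: generation_weight_ge0 pg.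
Qed.

Lemma measurable_gen_sum e r g : measurable_fun setT g -> (forall y, 0 <= g y) ->
  measurable_fun setT (gen_sum e r g).
Proof.
move=> mg g0.
(* Weights in a generation are nonnegative; absolute values make the summand nonnegative on all
   pairs, as [measurable_sum_seq] asks. *)
have -> : gen_sum e r g = fun w => \sum_(p <- gen r w) (`|p.2| ^+ e)%:E * g p.1.
  apply/funext => w; rewrite /gen_sum !big_seq; apply: eq_bigr => p pg.
  by rewrite ger0_norm//; exact: generation_weight_ge0 pg.
pose F (p : 'rV[R]_d * R) := (`|p.2| ^+ e)%:E * g p.1.
have mF : measurable_fun setT F.
  apply: emeasurable_funM; last exact: measurableT_comp.
  by apply/measurable_EFinP; apply: measurable_funX; exact: measurableT_comp.
have F0 p : 0 <= F p by rewrite mule_ge0// lee_fin exprn_ge0.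
exact: (measurable_sum_seq (generation_measurable S mA mC r) mF F0).
Qed.

Lemma gen_sum_ord e r g w N : size (gen r w) = N ->
  gen_sum e r g w = \sum_(j < N) (om j r w ^+ e)%:E * g (pos j r w).
Proof. by move=> <-; rewrite /gen_sum (big_nth (x, 1%R)) big_mkord. Qed.

Lemma sum_descendants e (U : set 'rV[R]_d) z (m : 'I_J) (o : R) g :
  (forall y, 0 <= g y) ->
  \sum_(p <- descendants mech A U z m o) (p.2 ^+ e)%:E * g p.1 =
  (o ^+ e)%:E * ((weight_sum e m)%:E * hitval A U g z).
Proof.
move=> g0; rewrite /descendants /hitval; case: hitting_time => [i|]; last first.
  by rewrite big_nil !mule0.
case: asboolP => Ai; first by rewrite big_nil !mule0.
rewrite big_map big_enum/= /weight_sum -sumEFin ge0_sume_distrl; last first.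
  by move=> k _; rewrite lee_fin exprn_ge0// weight_ge0.
rewrite ge0_sume_distrr; last first.
  by move=> k _; rewrite mule_ge0// lee_fin exprn_ge0// weight_ge0.
by apply: eq_bigr => k _; rewrite exprMn mulrC EFinM muleA.
Qed.

Lemma gen_sumS e r g w N : (forall y, 0 <= g y) -> size (gen r w) = N ->
  gen_sum e r.+1 g w = \sum_(j < N) (om j r w ^+ e)%:E *
    ((weight_sum e (M r j w))%:E * hitval A (C (l - r.+1)) g (path_at r j w)).
Proof.
move=> g0 <-; rewrite /gen_sum /= big_flatten big_map.
rewrite -[X in _ = X](big_mkord xpredT (fun j => (om j r w ^+ e)%:E *
    ((weight_sum e (M r j w))%:E * hitval A (C (l - r.+1)) g (path_at r j w)))).
by rewrite /index_iota subn0; apply: eq_bigr => j _; rewrite sum_descendants.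
Qed.

Let msizeN r N : measurable (sizeN r N).
Proof. exact: (seq_measurable_size N (generation_measurable S mA mC r)). Qed.

(** The law of a run is stated for a fixed generation size, so integrals are split over its
    values. *)
Lemma integral_size r (Phi : run_space S -> \bar R) : measurable_fun setT Phi ->
  (forall w, 0 <= Phi w) ->
  \int[P]_w Phi w = \sum_(N <oo) \int[P]_w ((\1_(sizeN r N) w)%:E * Phi w).
Proof.
move=> mPhi Phi0; rewrite -integral_nneseries//; last 2 first.
- by move=> N; apply: emeasurable_funM => //; exact/measurable_EFinP/measurable_indic.
- by move=> N w _; rewrite mule_ge0// lee_fin.
apply: eq_integral => w _.
rewrite (@nneseriesD1 _ _ (size (gen r w)))//; last by move=> N _; rewrite mule_ge0// lee_fin.
rewrite indicE mem_set// mul1e eseries0 ?adde0// => N _ /= NE.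
by rewrite indicE memNset ?mul0e// => /= E; rewrite E eqxx in NE.
Qed.

Let mom_history e j r :
  @measurable_fun _ _ (g_sigma_algebraType (history_generators (S := S) r)) _ setT
    (fun w => (om j r w ^+ e)%:E).
Proof.
have mj := seq_measurable_nth j (generation_history (S := S) mA mC (leqnn r)).
by apply/measurable_EFinP; apply: measurable_funX; exact: (measurableT_comp measurable_snd mj).
Qed.

Let ind r N w : \bar R := (\1_(sizeN r N) w)%:E.

(** The power of the weight is known from the history and goes into the factor [h]; all other
    particles receive the factor 1. *)
Let run_one e r N (j : 'I_N) f F : (r < l)%N -> @linked R d J D X mech f F ->
  \int[P]_w (ind r N w * ((om j r w ^+ e)%:E * f (path_at r j w) (M r j w))) =
  \int[P]_w (ind r N w * ((om j r w ^+ e)%:E * F (pos j r w))).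
Proof.
move=> rl fF.
pose f' i := if i == j :> nat then f else fun _ _ => 1.
pose F' i := if i == j :> nat then F else fun=> 1.
have fF' i : @linked R d J D X mech (f' i) (F' i).
  by rewrite /f' /F'; case: eqP => // _; exact: linked1.
have o0 w : 0 <= (om j r w ^+ e)%:E by rewrite lee_fin exprn_ge0.
have := @run_law_linked _ _ _ _ _ _ _ _ _ _ S mA mC Dx r N _ rl (@mom_history e j r) o0 f' F' fF'.
under eq_integral => w _.
  rewrite (bigD1 j)//= big1; last first.
    by move=> i; rewrite -(inj_eq val_inj) /f' => /negbTE ->.
  rewrite /f' eqxx mule1 -muleA; over.
move=> ->; apply: eq_integral => w _.
rewrite (bigD1 j)//= big1; last first.
  by move=> i; rewrite -(inj_eq val_inj) /F' => /negbTE ->.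
by rewrite /F' eqxx mule1 -muleA.
Qed.

(** Conditional independence of two distinct particles, with both weights in the history factor. *)
Let run_two r N (j k : 'I_N) f F : (r < l)%N -> j != k -> @linked R d J D X mech f F ->
  \int[P]_w (ind r N w * (((om j r w)%:E * f (path_at r j w) (M r j w)) *
                          ((om k r w)%:E * f (path_at r k w) (M r k w)))) =
  \int[P]_w (ind r N w * (((om j r w)%:E * F (pos j r w)) *
                          ((om k r w)%:E * F (pos k r w)))).
Proof.
move=> rl jk fF.
pose f' i := if (i == j :> nat) || (i == k :> nat) then f else fun _ _ => 1.
pose F' i := if (i == j :> nat) || (i == k :> nat) then F else fun=> 1.
have fF' i : @linked R d J D X mech (f' i) (F' i).
  by rewrite /f' /F'; case: ifP => // _; exact: linked1.
pose h w := (om j r w ^+ 1)%:E * (om k r w ^+ 1)%:E.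
have h0 w : 0 <= h w by rewrite mule_ge0// lee_fin exprn_ge0.
have mh : @measurable_fun _ _ (g_sigma_algebraType (history_generators (S := S) r)) _ setT h.
  by apply: emeasurable_funM; exact: mom_history.
have := @run_law_linked _ _ _ _ _ _ _ _ _ _ S mA mC Dx r N _ rl mh h0 f' F' fF'.
under eq_integral => w _.
  rewrite (bigD1 j)//= (bigD1 k)/=; last by rewrite eq_sym.
  rewrite big1; last first.
    by move=> i; rewrite -!(inj_eq val_inj) /f' => /andP[/negbTE -> /negbTE ->].
  rewrite /f' !eqxx orbT/= mule1 -muleA muleACA /h !expr1; over.
move=> ->; apply: eq_integral => w _.
rewrite (bigD1 j)//= (bigD1 k)/=; last by rewrite eq_sym.
rewrite big1; last first.
  by move=> i; rewrite -!(inj_eq val_inj) /F' => /andP[/negbTE -> /negbTE ->].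
by rewrite /F' !eqxx orbT/= mule1 -muleA muleACA /h !expr1.
Qed.

Let mind r N : measurable_fun setT (ind r N).
Proof. exact/measurable_EFinP/measurable_indic. Qed.

Let integral_size_sum r N (I : finType) (a : I -> run_space S -> \bar R)
    (Phi : run_space S -> \bar R) :
  (forall i, measurable_fun setT (a i)) -> (forall i w, 0 <= a i w) ->
  (forall w, size (gen r w) = N -> Phi w = \sum_i a i w) ->
  \int[P]_w (ind r N w * Phi w) = \sum_i \int[P]_w (ind r N w * a i w).
Proof.
move=> ma a0 PhiE; rewrite -ge0_integral_sum//; last 2 first.
- by move=> i; exact: emeasurable_funM.
- by move=> i w _; rewrite mule_ge0// lee_fin.
apply: eq_integral => w _; rewrite -ge0_sume_distrr//.
rewrite /ind indicE; have [/set_mem sw|] := boolP (w \in _); first by rewrite PhiE.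
by rewrite !mul0e.
Qed.

Let mom e j r : measurable_fun setT (fun w => (om j r w ^+ e)%:E).
Proof. exact: (history_measurable_fun mA mC (@mom_history e j r)). Qed.

Let mpos j r (g : 'rV[R]_d -> \bar R) : measurable_fun setT g ->
  measurable_fun setT (fun w => g (pos j r w)).
Proof.
move=> mg; apply: (measurableT_comp (f := g)) => //.
exact: (measurableT_comp measurable_fst (seq_measurable_nth j (generation_measurable S mA mC r))).
Qed.

(** By linearity each particle contributes its conditional mean. The scalar is 1 for [e = 1] when
    the mechanism is unbiased, and kappa for [e = 2]. *)
Lemma gen_sum_step e r g : (r < l)%N -> measurable_fun setT g -> (forall y, 0 <= g y) ->
  \int[P]_w gen_sum e r.+1 g w =
  (mech_E mech (weight_sum e))%:E * \int[P]_w gen_sum e r (pot (C (l - r.+1)) g) w.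
Proof.
move=> rl mg g0.
set pg := pot _ g.
have pg0 y : 0 <= pg y by exact: pot_ge0.
have mpg : measurable_fun setT pg by exact: measurable_pot.
have c0 : (0 <= mech_E mech (weight_sum e))%R.
  by apply: sumr_ge0 => m _; rewrite mulr_ge0// ?mech_law_ge0 ?weight_sum_ge0.
have fF := @linked_hitval _ _ _ _ X mech _ _ mA (mC (l - r.+1)) _ _ (weight_sum_ge0 e) mg g0.
rewrite -ge0_integralZl_EFin//; last 2 first.
- by move=> w _; exact: gen_sum_ge0.
- exact: measurable_gen_sum.
rewrite (integral_size r); last 2 first.
- exact: measurable_gen_sum.
- by move=> w; exact: gen_sum_ge0.
rewrite [RHS](integral_size r); last 2 first.
- by apply: measurable_funeM; exact: measurable_gen_sum.
- by move=> w; rewrite mule_ge0// gen_sum_ge0.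
apply: eq_eseriesr => N _.
rewrite (@integral_size_sum r N 'I_N (fun j w => (om j r w ^+ e)%:E *
    ((weight_sum e (M r j w))%:E * hitval A (C (l - r.+1)) g (path_at r j w)))); last 3 first.
- by move=> j; apply: emeasurable_funM => //; exact: (linked_run_measurable r j fF).
- move=> j w; rewrite !mule_ge0// ?lee_fin ?exprn_ge0 ?weight_sum_ge0//.
  exact: hitval_ge0.
- by move=> w sw; exact: gen_sumS.
rewrite (@integral_size_sum r N 'I_N (fun j w => (om j r w ^+ e)%:E *
    ((mech_E mech (weight_sum e))%:E * pg (pos j r w)))); last 3 first.
- by move=> j; apply: emeasurable_funM => //; apply: measurable_funeM; exact: mpos.
- by move=> j w; rewrite !mule_ge0// ?lee_fin ?exprn_ge0.
- move=> w sw; rewrite (gen_sum_ord e pg sw) ge0_sume_distrr.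
    by apply: eq_bigr => j _; rewrite muleCA.
  by move=> j _; rewrite mule_ge0// lee_fin exprn_ge0.
by apply: eq_bigr => j _; exact: (run_one e j rl fF).
Qed.

(* Distinct parents contribute independently given the past, so only the
   diagonal pairs differ from the first term. *)
Lemma gen_sum_sqr_step r g : unbiased mech -> (r < l)%N ->
  measurable_fun setT g -> (forall y, 0 <= g y) ->
  \int[P]_w (gen_sum 1 r.+1 g w ^+ 2) <=
  \int[P]_w (gen_sum 1 r (pot (C (l - r.+1)) g) w ^+ 2) +
  (mech_E mech (fun m => weight_sum 1 m ^+ 2)%R)%:E *
    \int[P]_w gen_sum 2 r (pot (C (l - r.+1)) (fun y => g y ^+ 2)) w.
Proof.
move=> unb rl mg g0; set V := C _.
have mV : measurable V by exact: mC.
have g20 y : 0 <= g y ^+ 2 by exact: expe_ge0.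
have mg2 : measurable_fun setT (fun y => g y ^+ 2).
  by under eq_fun do rewrite expe2; exact: emeasurable_funM.
set pg := pot V g; set pg2 := pot V (fun y => g y ^+ 2).
set c2 := mech_E mech _.
have pg0 y : 0 <= pg y by exact: pot_ge0.
have pg20 y : 0 <= pg2 y by exact: pot_ge0.
have mpg : measurable_fun setT pg by exact: measurable_pot.
have mpg2 : measurable_fun setT pg2 by exact: measurable_pot.
have w20 m : (0 <= weight_sum 1 m ^+ 2)%R by rewrite exprn_ge0// weight_sum_ge0.
have c20 : (0 <= c2)%R.
  by apply: sumr_ge0 => m _; rewrite mulr_ge0// mech_law_ge0.
have unb1 : mech_E mech (weight_sum 1) = 1%R.
  by rewrite -unb /mech_E; apply: eq_bigr => m _; congr (_ * _)%R; apply: eq_bigr => k _; rewrite expr1.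
pose f z (m : 'I_J) := (weight_sum 1 m)%:E * hitval A V g z.
pose f2 z (m : 'I_J) := (weight_sum 1 m ^+ 2)%:E * hitval A V (fun y => g y ^+ 2) z.
have fF : @linked R d J D X mech f pg.
  apply: eq_linked (linked_hitval mA mV (weight_sum_ge0 1) mg g0) => // y.
  by rewrite unb1 mul1e.
have fF2 : @linked R d J D X mech f2 (fun y => c2%:E * pg2 y).
  exact: linked_hitval.
(* The square of [f] is again a linked functional, since [hitval] evaluates at one point. *)
have ff2 z m : f z m * f z m = f2 z m.
  rewrite /f /f2 muleACA -EFinM -expr2; congr (_ * _); rewrite /hitval.
  by case: hitting_time => [i|]; rewrite ?mule0//; case: ifP; rewrite ?mule0// expe2.
have ms1 k h : measurable_fun setT h -> (forall y, 0 <= h y) ->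
    measurable_fun setT (fun w => gen_sum 1 k h w ^+ 2).
  by move=> mh h0; under eq_fun do rewrite expe2; apply: emeasurable_funM; exact: measurable_gen_sum.
rewrite -ge0_integralZl_EFin//; last 2 first.
- by move=> w _; exact: gen_sum_ge0.
- exact: measurable_gen_sum.
rewrite -ge0_integralD//; last 4 first.
- by move=> w _; rewrite expe_ge0// gen_sum_ge0.
- exact: ms1.
- by move=> w _; rewrite mule_ge0// gen_sum_ge0.
- by apply: measurable_funeM; exact: measurable_gen_sum.
rewrite (integral_size r); last 2 first.
- exact: ms1.
- by move=> w; rewrite expe_ge0// gen_sum_ge0.
rewrite [leRHS](integral_size r); last 2 first.
- by apply: emeasurable_funD; [exact: ms1|apply: measurable_funeM; exact: measurable_gen_sum].
- by move=> w; rewrite adde_ge0// ?expe_ge0 ?mule_ge0 ?gen_sum_ge0.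
apply: lee_nneseries => [N _ _|N _].
  by apply: integral_ge0 => w _; rewrite mule_ge0// ?lee_fin// expe_ge0// gen_sum_ge0.
(* [a] is the random contribution of a particle, [b] its conditional mean, and [e] the conditional
   mean of its square. *)
pose a j w := (om j r w)%:E * f (path_at r j w) (M r j w).
pose b j w := (om j r w)%:E * pg (pos j r w).
pose e j w := (om j r w ^+ 2)%:E * (c2%:E * pg2 (pos j r w)).
have a0 j w : 0 <= a j w by rewrite mule_ge0// ?lee_fin//; exact: (linked_ge0 fF).1.
have b0 j w : 0 <= b j w by rewrite mule_ge0// lee_fin.
have e0 j w : 0 <= e j w by rewrite !mule_ge0// lee_fin ?exprn_ge0.
have mom1 j : measurable_fun setT (fun w => (om j r w)%:E).
  by have := mom 1 j r; under eq_fun do rewrite expr1.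
have ma j : measurable_fun setT (a j).
  by apply: emeasurable_funM => //; exact: (linked_run_measurable r j fF).
have mb j : measurable_fun setT (b j).
  by apply: emeasurable_funM => //; exact: mpos.
have me j : measurable_fun setT (e j).
  by apply: emeasurable_funM => //; apply: measurable_funeM; exact: mpos.
rewrite (@integral_size_sum r N ('I_N * 'I_N)%type (fun p w => a p.1 w * a p.2 w)); last 3 first.
- by move=> p; exact: emeasurable_funM.
- by move=> p w; rewrite mule_ge0.
- move=> w sw; rewrite (gen_sumS 1 g0 sw) -(sqre_sum_pairs (a := fun j => a j w))//.
rewrite (@integral_size_sum r N ('I_N * 'I_N)%type
  (fun p w => b p.1 w * b p.2 w + (if p.1 == p.2 then e p.1 w else 0))); last 3 first.
- move=> p; apply: emeasurable_funD; first exact: emeasurable_funM.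
  by case: (p.1 == p.2).
- by move=> p w; apply: adde_ge0; [exact: mule_ge0|case: (p.1 == p.2)].
- move=> w sw; rewrite big_split/= -(sqre_sum_pairs (a := fun j => b j w))//; congr (_ + _).
    rewrite (gen_sum_ord 1 pg sw).
    by rewrite (eq_bigr (fun j : 'I_N => b j w))// => j _; rewrite expr1.
  rewrite (gen_sum_ord 2 pg2 sw) ge0_sume_distrr; last first.
    by move=> j _; rewrite mule_ge0// lee_fin exprn_ge0.
  rewrite -(pair_bigA _ (fun i j : 'I_N => if i == j then e i w else 0))/=.
  apply: eq_bigr => j _; rewrite (bigD1 j)//= eqxx big1 ?adde0//.
    by rewrite muleCA.
  by move=> i; rewrite eq_sym => /negbTE ->.
(* Off the diagonal the integrals agree by independence; on it the excess [b * b] is kept, whence an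
   inequality. *)
apply: lee_sum => -[j k] _ /=.
have [->|jk] := eqVneq j k; last first.
  rewrite (run_two rl jk fF); under [leRHS]eq_integral do rewrite adde0.
  exact: lexx.
have -> : \int[P]_w (ind r N w * (a k w * a k w)) = \int[P]_w (ind r N w * e k w).
  rewrite -(run_one 2 k rl fF2); apply: eq_integral => w _.
  by rewrite /a muleACA ff2 -EFinM -expr2.
apply: ge0_le_integral => //.
- by move=> w _; rewrite mule_ge0// lee_fin.
- exact: emeasurable_funM.
- apply: emeasurable_funM => //; apply: emeasurable_funD => //; exact: emeasurable_funM.
- by move=> w _; rewrite lee_wpmul2l ?lee_fin// leeDr// mule_ge0.
Qed.

End moments.

(** * Two-sided bounds on the second moment of the sample *)

Section second_moment.
Local Open Scope ereal_scope.
Context {R : realType} {d J : nat} {D : set 'rV[R]_d} {X : markov_chain D}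
  {mech : splitting_mechanism R J} {A B : set 'rV[R]_d} {C : nat -> set 'rV[R]_d}
  {l : nat} {x : 'rV[R]_d}.
Variable S : splitting_run X mech A C l x.
Hypotheses (mA : measurable A) (mB : measurable B).
Hypotheses (mC : forall j, measurable (C j)) (C0 : C 0%N = B).
Hypotheses (Cle : forall i j, (i <= j)%N -> C i `<=` C j).
Hypotheses (Dx : D x) (l0 : (0 < l)%N) (unb : unbiased mech).

Local Notation P := (run_prob S).
Local Notation pot := (pot (chain_ker X) A).
Local Notation p := (reach X A B).
Local Notation gen_sum := (@gen_sum R d J D X mech A C l x S).

Local Notation kappa := (mech_E mech (@weight_sum R J mech 2)).
Local Notation c2 := (mech_E mech (fun m => @weight_sum R J mech 1 m ^+ 2)%R).

Let BC j : B `<=` C j. Proof. by rewrite -C0; exact: Cle. Qed.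

Let kappa_ge0 : (0 <= kappa)%R.
Proof. by apply: sumr_ge0 => m _; rewrite mulr_ge0// ?mech_law_ge0 ?weight_sum_ge0. Qed.

(** Each generation contributes one scalar and leaves an invariant [u] unchanged. It is used with
    [u = p] for the lower bound and with a hitting mean of [p ^ 2] for the upper one. *)
Lemma integral_gen_sum_invariant e r (u : 'rV[R]_d -> \bar R) :
  measurable_fun setT u -> (forall y, 0 <= u y) -> (r <= l)%N ->
  (forall i, (i < r)%N -> pot (C (l - i.+1)) u = u) ->
  \int[P]_w gen_sum e r u w = (mech_E mech (@weight_sum R J mech e) ^+ r)%:E * u x.
Proof.
move=> mu u0; elim: r => [_ _|r ih rl pu].
  rewrite expr0 mul1e.
  have gE w : gen_sum e 0 u w = u x by rewrite /gen_sum /= big_seq1 expr1n mul1e.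
  under eq_integral do rewrite gE.
  by rewrite integral_cst// [X in _ * X]probability_setT mule1.
rewrite gen_sum_step// pu// ih ?(ltnW rl)//; last by move=> i ir; apply: pu; exact: ltnW.
by rewrite muleA -EFinM exprS.
Qed.

Let mp : measurable_fun setT p. Proof. exact: measurable_reach. Qed.
Let p0 y : 0 <= p y. Proof. exact: reach_ge0. Qed.

Let pot_p j : pot (C j) p = p.
Proof. by apply/funext => y; apply: pot_reach. Qed.

Lemma sample_sqrE w : (s_SA w ^+ 2)%:E = gen_sum 1 l (cst 1) w ^+ 2 :> \bar R.
Proof.
rewrite /s_SA /splitting_sample /gen_sum expe2 expr2 EFinM -sumEFin.
by congr (_ * _); apply: eq_bigr => q _; rewrite mule1 expr1.
Qed.

(** Weights are nonnegative, so dropping the cross terms bounds the square below by the sum of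
    squared weights, whose mean is explicit. *)
Lemma sample_sqr_ge : (kappa ^+ l)%:E * p x <= \int[P]_w (s_SA w ^+ 2)%:E.
Proof.
(* The last generation is split off: its test function is the constant 1, and [pot B] turns it into
   the invariant [p]. *)
have -> : (kappa ^+ l)%:E * p x = \int[P]_w gen_sum 2 l (cst 1) w.
  have ll : (l.-1 < l)%N by rewrite prednK.
  have -> : gen_sum 2 l = gen_sum 2 l.-1.+1 by rewrite prednK.
  rewrite gen_sum_step// prednK// subnn C0 (@integral_gen_sum_invariant 2 l.-1 p)//.
    by rewrite muleA -EFinM -exprS prednK.
  exact: ltnW.
apply: ge0_le_integral => //.
- by move=> w _; exact: gen_sum_ge0.
- exact: measurable_gen_sum.
- under eq_fun do rewrite sample_sqrE expe2.
  by apply: emeasurable_funM; exact: measurable_gen_sum.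
move=> w _; rewrite /s_SA /splitting_sample /gen_sum.
under eq_bigr do rewrite mule1.
rewrite sumEFin lee_fin.
have : forall q, q \in generation mech A C l x (@run_path _ _ _ _ _ _ _ _ _ _ S)
    (@run_mark _ _ _ _ _ _ _ _ _ _ S) l w ->
   (0 <= q.2)%R by move=> q; exact: generation_weight_ge0.
elim: (generation _ _ _ _ _ _ _ _ _) => [|q s ih] s0.
  by rewrite !big_nil expr0n.
rewrite !big_cons.
have s1 : (0 <= \sum_(j <- s) j.2)%R.
  by rewrite big_seq; apply: sumr_ge0 => i si; rewrite s0// in_cons si orbT.
have q0 : (0 <= q.2)%R by rewrite s0// mem_head.
have := ih (fun i si => s0 i (mem_behead (s := q :: s) si)).
by rewrite sqrrD; nra.
Qed.

Let mp2 : measurable_fun setT (fun y => p y ^+ 2).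
Proof. by under eq_fun do rewrite expe2; exact: emeasurable_funM. Qed.

Let p20 y : 0 <= p y ^+ 2. Proof. exact: expe_ge0. Qed.

Let level_moment r := (kappa ^+ r)%:E * pot (C (l - r.+1)) (fun y => p y ^+ 2) x.

Let level_momentE r : (r < l)%N ->
  \int[P]_w gen_sum 2 r (pot (C (l - r.+1)) (fun y => p y ^+ 2)) w = level_moment r.
Proof.
move=> rl; apply: integral_gen_sum_invariant => //.
- exact: measurable_pot.
- by move=> y; exact: pot_ge0.
- exact: ltnW.
move=> i ir; apply/funext => y; apply: pot_pot => //; apply: Cle.
by rewrite leq_sub2l// ltnW.
Qed.

(** [gen_sum_sqr_step] is summed with test function [p] over all generations but the last. There the
    test function is 1, which agrees with [p] at the points of [B] outside [A]. *)
Lemma sample_sqr_le :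
  \int[P]_w (s_SA w ^+ 2)%:E <= p x ^+ 2 + c2%:E * \sum_(r < l)
    ((kappa ^+ r)%:E * pot (C (l - r.+1)) (fun y => p y ^+ 2) x).
Proof.
have c20 : (0 <= c2)%R.
  by apply: sumr_ge0 => m _; rewrite mulr_ge0// ?mech_law_ge0// exprn_ge0// weight_sum_ge0.
have lm0 r : 0 <= level_moment r.
  by rewrite mule_ge0// ?lee_fin ?exprn_ge0//; exact: pot_ge0.
have h r : (r < l)%N ->
    \int[P]_w (gen_sum 1 r p w ^+ 2) <= p x ^+ 2 + c2%:E * \sum_(i < r) level_moment i.
  elim: r => [_|r ih rl].
    rewrite big_ord0 mule0 adde0.
    have gE w : gen_sum 1 0 p w = p x by rewrite /gen_sum /= big_seq1 expr1n mul1e.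
    under eq_integral do rewrite gE.
    by rewrite integral_cst// [X in _ * X]probability_setT mule1.
  have rl' := ltnW rl.
  apply: le_trans (gen_sum_sqr_step S mA mC Dx unb rl' mp p0) _.
  rewrite pot_p level_momentE// big_ord_recr/= ge0_muleDr//; last exact: sume_ge0.
  by rewrite addeA leeD2r// ih.
have ll : (l.-1 < l)%N by rewrite prednK.
under eq_integral do rewrite sample_sqrE.
have -> : gen_sum 1 l = gen_sum 1 l.-1.+1 by rewrite prednK.
apply: le_trans (gen_sum_sqr_step S mA mC Dx unb ll (@measurable_cst _ _ _ _ setT 1) (fun=> lee01)) _.
rewrite prednK// subnn C0.
have -> : pot B (fun y => cst 1 y ^+ 2) = pot (C (l - l.-1.+1)) (fun y => p y ^+ 2).
  apply/funext => y; rewrite prednK// subnn C0; apply: eq_pot => z Bz.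
  by rewrite [p z](@pot_on _ _ _ X _ mA B (cst 1))//=.
rewrite level_momentE//.
have -> : \sum_(r < l) level_moment r = \sum_(r < l.-1.+1) level_moment r by rewrite prednK.
rewrite big_ord_recr/=.
rewrite ge0_muleDr//; last exact: sume_ge0.
by rewrite addeA leeD2r// h.
Qed.

End second_moment.

(* No measurability of [f]: the integrand of [action] need not be measurable. *)
Lemma ge0_le_integral_subset {R : realType} d (T : measurableType d)
    (mu : {measure set T -> \bar R}) (E F : set T) (f : T -> \bar R) :
  E `<=` F -> (forall x, 0 <= f x)%E -> (\int[mu]_(x in E) f x <= \int[mu]_(x in F) f x)%E.
Proof.
move=> EF f0; rewrite !ge0_integralE//.
apply: ereal_sup_le => _ [h hE <-]; exists h => // x; apply: le_trans (hE x) _.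
rewrite !patchE; case: ifPn => [/set_mem Ex|_]; first by rewrite mem_set//; exact: EF.
by case: ifP.
Qed.

(** * Subsolutions bound the quasipotential *)

Section subsolution.
Context {R : realType} {d : nat}.
Variables (D A B : set 'rV[R]_d) (L : 'rV[R]_d -> 'rV[R]_d -> \bar R) (U : 'rV[R]_d -> R).
Hypotheses (L0 : forall u v, (0 <= L u v)%E) (U_cont : {within D, continuous U}).
Hypothesis U_sub : forall y z, (D `\` (A `|` B)) y -> (D `\` (A `|` B)) z ->
  ((U y - U z)%:E <= J_fun D L y z)%E.
Hypothesis U_B : forall y, B y -> U y <= 0.

Lemma W_fun_ge0 y : (0 <= W_fun D A B L y)%E.
Proof.
by apply: le_ereal_inf_tmp => _ [t [phi [_ _ _ _ ->]]]; exact: integral_ge0.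
Qed.

Lemma within_continuous_ball (y : 'rV[R]_d) (e : R) : D y -> 0 < e ->
  exists2 del : R, 0 < del & forall z, D z -> `|y - z| < del -> `|U y - U z| < e.
Proof.
move=> Dy e0; have /subspace_continuousP/(_ y Dy) := U_cont.
move=> /cvgrPdist_lt/(_ e e0); rewrite near_withinE => /nbhs_ballP[del del0 H].
exists del => // z Dz yz; apply: H => //.
by rewrite -ball_normE.
Qed.

Lemma action_restrict (s t : R) (phi : R -> 'rV[R]_d) : s <= t -> (action L s phi <= action L t phi)%E.
Proof.
move=> st; apply: ge0_le_integral_subset => // u /=.
by rewrite !in_itv/= => /andP[-> us]; exact: le_trans us st.
Qed.

Lemma trajectory_restrict (s t : R) (phi : R -> 'rV[R]_d) : 0 <= s <= t ->
  trajectory D t phi -> trajectory D s phi.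
Proof.
move=> /andP[s0 st] [t0 ac Dphi]; split=> //; last first.
  by move=> u /andP[u0 us]; apply: Dphi; rewrite u0 (le_trans us).
move=> e e0; have [del del0 H] := ac e e0; exists del => // k u v uv dis.
by apply: H => // i; have [? ? vs] := uv i; split=> //; exact: le_trans st.
Qed.

(** Absolute continuity with a single interval. *)
Lemma trajectory_continuous (t : R) (phi : R -> 'rV[R]_d) (e : R) : trajectory D t phi -> 0 < e ->
  exists2 del : R, 0 < del & forall u v : R, 0 <= u <= t -> 0 <= v <= t -> `|u - v| < del ->
    `|phi u - phi v| < e.
Proof.
move=> [t0 ac _] e0; have [del del0 H] := ac e e0; exists del => //.
have main (u v : R) : 0 <= u -> u <= v -> v <= t -> v - u < del -> `|phi v - phi u| < e.
  move=> u0 uv vt dvu; have := H 1%N (fun=> u) (fun=> v).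
  rewrite !big_ord1; apply => // i j; by rewrite !ord1.
move=> u v /andP[u0 ut] /andP[v0 vt]; have [uv|vu] := leP u v.
  rewrite ler0_norm ?subr_le0// opprB => duv; rewrite distrC; exact: main.
by rewrite gtr0_norm ?subr_gt0// => duv; apply: main => //; exact: ltW.
Qed.

(** If a path had action [a < U y], then [U] would be at least [U y - a > 0] along it until it
    enters [B], where [U <= 0]; continuity of [U] along the path forbids such a jump. *)
Lemma subsolution_le_W y : D y -> ((U y)%:E <= W_fun D A B L y)%E.
Proof.
move=> Dy; apply: le_ereal_inf_tmp => _ [t [phi [traj phi0 Bphi Aphi ->]]].
have act0 : (0 <= action L t phi)%E by exact: integral_ge0.
have [By|nBy] := pselect (B y).
  by apply: le_trans act0; rewrite lee_fin U_B.
rewrite leNgt; apply/negP => lt_act.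
have [a aE] : exists a, action L t phi = a%:E.
  by move: act0 lt_act; case: action => // a _ _; exists a.
move: act0 lt_act; rewrite aE lee_fin lte_fin => a0 aU.
have [t0 _ Dphi] := traj.
pose eta := U y - a.
have eta0 : 0 < eta by rewrite subr_gt0.
(* As long as [B] has not been met the subsolution inequality applies, and the action spent is at
   most [a]. *)
have before (s : R) : 0 <= s <= t -> (forall u : R, 0 <= u <= s -> ~ B (phi u)) -> eta <= U (phi s).
  move=> /andP[s0 st] nB.
  have stt : 0 <= s <= t by rewrite s0.
  have in1 : (D `\` (A `|` B)) y.
    split=> //; case=> //; rewrite -phi0; apply: Aphi; by rewrite lexx.
  have in2 : (D `\` (A `|` B)) (phi s).
    split; first exact: Dphi.
    by case; [exact: Aphi|apply: nB; rewrite s0/=].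
  have : ((U y - U (phi s))%:E <= a%:E)%E.
    apply: le_trans (U_sub in1 in2) _; rewrite -aE.
    apply: le_trans (action_restrict phi st); apply: ereal_inf_lbound.
    by exists s, phi; split=> //; exact: trajectory_restrict traj.
  by rewrite lee_fin /eta; lra.
pose T := [set s : R | 0 <= s <= t /\ B (phi s)].
have Tinf : has_inf T.
  by split; [exists t; split=> //; rewrite t0/=|exists 0 => s [/andP[]]].
pose ts := inf T.
have ts0 : 0 <= ts by apply: lb_le_inf => [|s [/andP[]]//]; case: Tinf.
have tsT s : T s -> ts <= s by apply: ge_inf; case: Tinf.
have tst : ts <= t by apply: tsT; split=> //; rewrite t0/=.
have tsI : 0 <= ts <= t by rewrite ts0.
have e20 : 0 < eta / 2 by rewrite divr_gt0.
have [rho rho0 Hrho] := within_continuous_ball (Dphi _ tsI) e20.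
have [del del0 Hdel] := trajectory_continuous traj rho0.
have near (s : R) : 0 <= s <= t -> `|ts - s| < del -> `|U (phi ts) - U (phi s)| < eta / 2.
  by move=> sI sd; apply: Hrho; [exact: Dphi|exact: Hdel].
(* The infimum [ts] may not be attained, so a time [b] in [T] close to it is used instead. *)
have [b Tb bts] := inf_adherent del0 Tinf.
have [bI Bb] := Tb.
have nb : `|U (phi ts) - U (phi b)| < eta / 2.
  apply: near => //; rewrite ler0_norm ?subr_le0 ?tsT// opprB; move: bts; rewrite -/ts; lra.
(* Strictly before [ts], except when [ts = 0]; then [s = 0] and [phi 0 = y] is outside [B]. *)
pose s := Num.max 0 (ts - del / 2).
have s0 : 0 <= s by rewrite le_max lexx.
have sts : s <= ts by rewrite ge_max ts0/=; lra.
have sI : 0 <= s <= t by rewrite s0 (le_trans sts).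
have tss : ts - s < del.
  have : ts - del / 2 <= s by rewrite le_max lexx orbT.
  lra.
have ns : `|U (phi ts) - U (phi s)| < eta / 2.
  by apply: near => //; rewrite ger0_norm ?subr_ge0.
have es : eta <= U (phi s).
  apply: before => // u /andP[u0 us] Bu.
  have [u00|un0] := eqVneq u 0; first by apply: nBy; rewrite -phi0 -u00.
  have up : 0 < u by rewrite lt_neqAle eq_sym un0.
  have : ts <= u by apply: tsT; split=> //; rewrite u0 (le_trans us) ?(le_trans sts).
  move: us; rewrite le_max leNgt up/= => us; lra.
have Ub : U (phi b) <= 0 by exact: U_B.
move: nb ns; rewrite !ltr_norml => /andP[n1 n2] /andP[n3 n4]; clear - n1 n2 n3 n4 es Ub eta0; lra.
Qed.

End subsolution.

(** * Exponential rates *)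

Section rate.
Context {R : realType}.
Implicit Types (a : \bar R) (t : R).

(** Trades a bound on [rate] for an exponential bound; the conventions for the logarithm cover
    [a = 0] and [a = +oo]. *)
Lemma rate_ge n a t : (0 < n)%N -> (0 <= a)%E ->
  (t%:E <= rate n a)%E = (a <= (expR (- (n%:R * t)))%:E)%E.
Proof.
move=> n0 a0; have n0R : 0 < n%:R :> R by rewrite ltr0n.
have nV : 0 < n%:R^-1 :> R by rewrite invr_gt0.
case: a a0 => [r| |] //; rewrite /rate /=; last first.
  by move=> _; rewrite lt0_muley ?lte_fin ?oppr_lt0// !leNgt ltNyr ltry.
rewrite lee_fin => r0; case: ifPn => [r0'|].
  have -> : r = 0 by apply/eqP; rewrite eq_le r0'.
  by rewrite lt0_muleNy ?lte_fin ?oppr_lt0// leey lee_fin expR_ge0.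
rewrite -ltNge => rp; rewrite -EFinM !lee_fin -[r in RHS]lnK ?posrE// ler_expR.
by rewrite mulNr lerNr ler_pdivrMl// mulrN.
Qed.

Lemma rate_le n a t : (0 < n)%N -> (0 <= a)%E ->
  (rate n a <= t%:E)%E = ((expR (- (n%:R * t)))%:E <= a)%E.
Proof.
move=> n0 a0; have n0R : 0 < n%:R :> R by rewrite ltr0n.
have nV : 0 < n%:R^-1 :> R by rewrite invr_gt0.
case: a a0 => [r| |] //; rewrite /rate /=; last first.
  by move=> _; rewrite lt0_muley ?lte_fin ?oppr_lt0// leNye leey.
rewrite lee_fin => r0; case: ifPn => [r0'|].
  have -> : r = 0 by apply/eqP; rewrite eq_le r0'.
  by rewrite lt0_muleNy ?lte_fin ?oppr_lt0// !leNgt ltry lte_fin expR_gt0.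
rewrite -ltNge => rp; rewrite -EFinM !lee_fin -[r in RHS]lnK ?posrE// ler_expR.
by rewrite mulNr lerNl ler_pdivlMl// mulrN.
Qed.

Lemma cvge_bounds (u : nat -> \bar R) (l : \bar R) : l != -oo%E ->
  (forall t : R, (t%:E < l)%E -> \forall n \near \oo, (t%:E <= u n)%E) ->
  (forall t : R, (l < t%:E)%E -> \forall n \near \oo, (u n <= t%:E)%E) ->
  u n @[n --> \oo] --> l.
Proof.
case: l => [l| |] // _ lo hi; last first.
  by apply/cvgeyPge => t; apply: lo; exact: ltry.
have H e : 0 < e -> \forall n \near \oo, ((l - e)%:E <= u n <= (l + e)%:E)%E.
  move=> e0.
  have h1 : ((l - e)%:E < l%:E)%E by rewrite lte_fin; lra.
  have h2 : (l%:E < (l + e)%:E)%E by rewrite lte_fin; lra.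
  by apply: filterS2 (lo _ h1) (hi _ h2) => n -> ->.
apply/fine_cvgP; split.
  apply: filterS (H 1 ltr01) => n /andP[a1 a2]; rewrite fin_numElt.
  by rewrite (lt_le_trans _ a1) ?ltNyr//= (le_lt_trans a2)// ltry.
apply/cvgrPdist_le => e e0; apply: filterS (H e e0) => n /=.
case: (u n) => [r| |] //=; rewrite ?lee_fin.
- by move=> /andP[a1 a2]; rewrite ler_norml; apply/andP; split; lra.
- by move=> /andP[_]; rewrite leNgt ltry.
Qed.

End rate.

(** * From moment bounds to exponential rates *)

Section asymptotics.
Context {R : realType}.

(* If [v < z], the last grid point is [v] and the error is [z - v], which the
   convergence of the number of levels makes small. *)
Lemma grid_below (v z : R) (K : nat) : (0 < K)%N -> 0 <= v -> 0 <= z ->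
  exists2 i : 'I_K.+1, i%:R * (v / K%:R) <= z &
    (z <= i%:R * (v / K%:R) + v / K%:R) || (z <= i%:R * (v / K%:R) + (z - v)).
Proof.
move=> K0 v0 z0; have K0R : 0 < K%:R :> R by rewrite ltr0n.
have [vz|zv] := leP v z.
  exists ord_max; first by rewrite /= mulrCA divff ?mulr1// gt_eqF.
  by apply/orP; right; rewrite /= mulrCA divff ?mulr1 ?gt_eqF//; lra.
suff [i [iK h1 h2]] : exists i, [/\ (i <= K)%N, i%:R * (v / K%:R) <= z & z <= i%:R * (v / K%:R) + v / K%:R].
  by exists (Ordinal (iK : (i < K.+1)%N)) => //=; rewrite h2.
have : z <= K%:R * (v / K%:R) by rewrite mulrCA divff ?mulr1 ?gt_eqF// ltW.
have : 0 <= v / K%:R by rewrite divr_ge0// ltW.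
elim: K {K0 K0R} (v / _) => [|K ih] q q0.
  by rewrite mul0r => z0'; exists 0%N; split=> //; rewrite mul0r ?add0r// (le_trans z0').
move=> zq; have [zK|Kz] := leP z (K%:R * q).
  by have [i [iK h1 h2]] := ih q q0 zK; exists i; split=> //; exact: leqW.
exists K; split=> //; first exact: ltW.
by move: zq; rewrite -natr1 mulrDl mul1r.
Qed.

(** [E n] stands for the second moment, [p n] for the hitting probability, [X n z] for the cross
    moment at level [z], [l n] for the number of generations, [v] for V(x) and [b] for log kappa. *)
Variables (E p : nat -> \bar R) (X : nat -> R -> \bar R) (l : nat -> nat).
Variables (W : \bar R) (v b Delta c : R).
Hypotheses (v0 : 0 <= v) (Delta0 : 0 < Delta) (c0 : 0 <= c).
Hypotheses (E0 : forall n, (0 <= E n)%E) (p0 : forall n, (0 <= p n)%E)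
  (X0 : forall n z, (0 <= X n z)%E).
Hypothesis W_Ny : W != -oo%E.

Hypothesis rate_p : rate n (p n) @[n --> \oo] --> W.
Hypothesis rate_X : forall z t : R, 0 <= z <= v -> ((t + b * z / Delta)%:E < W)%E ->
  \forall n \near \oo, (t%:E <= rate n (X n z))%E.
Hypothesis X_le : forall n z z', 0 <= z -> z <= z' -> (X n z' <= X n z)%E.
Hypothesis l_cvg : (l n)%:R / n%:R @[n --> \oo] --> v / Delta.

Let near_ge (u : nat -> \bar R) (a : R) : u n @[n --> \oo] --> W -> (a%:E < W)%E ->
  \forall n \near \oo, (a%:E <= u n)%E.
Proof.
move=> uW aW.
have h : \forall n \near \oo, (a%:E < u n)%E := uW _ (open_ereal_gt' aW).
by apply: filterS h => n; exact: ltW.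
Qed.

Let near_le (u : nat -> \bar R) (a : R) : u n @[n --> \oo] --> W -> (W < a%:E)%E ->
  \forall n \near \oo, (u n <= a%:E)%E.
Proof.
move=> uW aW.
have h : \forall n \near \oo, (u n < a%:E)%E := uW _ (open_ereal_lt' aW).
by apply: filterS h => n; exact: ltW.
Qed.

Let l_near e : 0 < e -> \forall n \near \oo, (0 < n)%N /\ `|b| * `|(l n)%:R - n%:R * (v / Delta)| <= n%:R * e.
Proof.
move=> e0; have b1 : 0 < `|b| + 1 by rewrite ltr_wpDl.
(* Adding 1 avoids a division by zero when [b = 0]. *)
have e1 : 0 < e / (`|b| + 1) by rewrite divr_gt0.
have /cvgrPdist_le/(_ _ e1) := l_cvg.
apply: filterS2 (nbhs_infty_ge 1) => n /= n0.
have n0R : 0 < n%:R :> R by rewrite ltr0n.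
have -> : v / Delta - (l n)%:R / n%:R = - (((l n)%:R - n%:R * (v / Delta)) / n%:R).
  by field; rewrite !gt_eqF.
rewrite normrN normrM normfV (gtr0_norm n0R) ler_pdivrMr// => h; split=> //.
have := normr_ge0 b; set x := `|(l n)%:R - _| in h *; move=> b0.
have x0 : 0 <= x by exact: normr_ge0.
apply: (@le_trans _ _ ((`|b| + 1) * x)); first by rewrite ler_wpM2r// lerDl.
by rewrite mulrC -ler_pdivlMr//; rewrite mulrC mulrA in h.
Qed.

(** The terms, of order [n] in number, are each at most [exp (- n (t + e))], and [exp (n e)] absorbs
    their number. A cross moment is replaced by the one at a grid point below its level, so finitely
    many eventual bounds suffice. *)
Lemma rate_lower_bound :
  (\forall n \near \oo, (E n <= c%:E * ((expR (b * (l n).-1%:R))%:E * p n +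
     \sum_(r < (l n).-1) (expR (b * r%:R))%:E *
        X n (((l n).-2 - r)%:R * Delta / n%:R)))%E) ->
  forall t : R, (t%:E < W - (v * (b / Delta))%:E)%E ->
    \forall n \near \oo, (t%:E <= rate n (E n))%E.
Proof.
move=> E_le t tW; pose theta := t + v * (b / Delta).
have thetaW : (theta%:E < W)%E by rewrite /theta EFinD -lteBrDr.
have [e e0 eW] : exists2 e, 0 < e & ((theta + 6 * e)%:E < W)%E.
  case: (W) thetaW => [w| |] //; last by move=> _; exists 1 => //; exact: ltry.
  by rewrite lte_fin => tw; exists ((w - theta) / 7); rewrite ?lte_fin; lra.
(* Enough room for four errors of size [e]: the number of levels, a shift by two levels, the
   distance to the grid, and the number of terms. *)
pose w := theta + 6 * e.
(* The mesh [v / K] is chosen so that moving a level to the grid costs at most [e] in the rate. *)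
have [K K0 HK] : exists2 K, (0 < K)%N & `|b| * v / Delta <= e * K%:R.
  have [K HK] : exists K : nat, `|b| * v / Delta / e < K%:R.
    by eexists; apply: archi_boundP; rewrite !divr_ge0// ?mulr_ge0// ltW.
  exists K.+1 => //; rewrite [leRHS]mulrC -ler_pdivrMr//.
  by rewrite (le_trans (ltW HK))// ler_nat.
pose zz (i : 'I_K.+1) := i%:R * (v / K%:R).
have K0R : 0 < K%:R :> R by rewrite ltr0n.
have zz_in i : 0 <= zz i <= v.
  rewrite /zz mulr_ge0 ?divr_ge0//=.
  rewrite mulrCA -[leRHS]mulr1 ler_wpM2l// ler_pdivrMr// mul1r ler_nat.
  by rewrite -ltnS.
have H1 := near_ge rate_p eW.
(* One threshold in [n] serves the whole grid because the grid is finite. *)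
have H2 : \forall n \near \oo, forall i, ((w - b * zz i / Delta)%:E <= rate n (X n (zz i)))%E.
  by apply: filter_forall => i; apply: rate_X => //; rewrite subrK.
have H3 := l_near e0.
have H4 : \forall n \near \oo, 2 * `|b| <= n%:R * e.
  apply: filterS (nbhs_infty_ger (2 * `|b| / e)) => n /=.
  by rewrite ler_pdivrMr.
have H5 : \forall n \near \oo, (l n)%:R <= n%:R * (v / Delta + 1).
  have /cvgrPdist_le/(_ _ ltr01) := l_cvg.
  apply: filterS2 (nbhs_infty_ge 1) => n /= n0.
  have n0R : 0 < n%:R :> R by rewrite ltr0n.
  rewrite ler_norml => /andP[h _]; rewrite mulrC -ler_pdivrMr//; lra.
(* From [y <= expR y] at [y = n e / 2], squared: the exponential beats a linear function of [n]. *)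
have H6 : \forall n \near \oo, c * (n%:R * (v / Delta + 2)) <= expR (n%:R * e).
  apply: filterS (nbhs_infty_ger (4 * c * (v / Delta + 2) / e ^+ 2)) => n /=.
  rewrite ler_pdivrMr ?exprn_gt0// => h.
  have -> : n%:R * e = (n%:R * e / 2) + (n%:R * e / 2) by lra.
  rewrite expRD.
  have h1 : n%:R * e / 2 <= expR (n%:R * e / 2).
    by apply: le_trans (expR_ge1Dx _); lra.
  apply: (@le_trans _ _ ((n%:R * e / 2) * (n%:R * e / 2))); last first.
    by apply: ler_pM => //; rewrite !mulr_ge0// ltW.
  have : n%:R * (4 * c * (v / Delta + 2)) <= n%:R * (n%:R * e ^+ 2) by rewrite ler_wpM2l.
  by rewrite expr2; set q := v / Delta; nra.
near=> n.
have [n0 ln] : (0 < n)%N /\ `|b| * `|(l n)%:R - n%:R * (v / Delta)| <= n%:R * e by near: n.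
have n0R : 0 < n%:R :> R by rewrite ltr0n.
rewrite rate_ge//.
have expE (r : R) (u : \bar R) (y : R) : (0 <= u)%E -> (y%:E <= rate n u)%E ->
    b * r - n%:R * y <= - (n%:R * (t + e)) ->
    ((expR (b * r))%:E * u <= (expR (- (n%:R * (t + e))))%:E)%E.
  move=> u0; rewrite rate_ge// => uy h.
  apply: (@le_trans _ _ ((expR (b * r))%:E * (expR (- (n%:R * y)))%:E)%E).
    by rewrite lee_wpmul2l// lee_fin expR_ge0.
  by rewrite -EFinM -expRD lee_fin ler_expR.
pose q := (expR (- (n%:R * (t + e)))).
have bln : b * ((l n)%:R - n%:R * (v / Delta)) <= n%:R * e.
  by apply: le_trans ln; rewrite -normrM ler_norm.
have b_le : - b <= `|b| by rewrite -normrN ler_norm.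
have b2 : 2 * `|b| <= n%:R * e by near: n.
have b0 := normr_ge0 b.
have pq : ((expR (b * (l n).-1%:R))%:E * p n <= q%:E)%E.
  apply: (expE _ _ w) => //; first by near: n.
  have -> : b * (l n).-1%:R = b * ((l n)%:R - n%:R * (v / Delta)) + n%:R * (v * (b / Delta))
    - b * ((l n)%:R - (l n).-1%:R).
    by field; rewrite gt_eqF.
  have : - b * ((l n)%:R - (l n).-1%:R) <= `|b|.
    case: (l n) => [|k] /=; first by rewrite subrr mulr0.
    by rewrite -natr1 addrC addKr mulr1.
  by rewrite /w /theta; nra.
have Xq (r : 'I_(l n).-1) :
    ((expR (b * r%:R))%:E * X n (((l n).-2 - r)%:R * Delta / n%:R) <= q%:E)%E.
  set z := _ * Delta / _.
  have [l2 rl] : (2 <= l n)%N /\ (r <= (l n).-2)%N.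
    by move: (nat_of_ord r) (ltn_ord r) => m; case: (l n) => [|[|k]].
  have zE : n%:R * z / Delta = (l n)%:R - 2 - r%:R.
    rewrite /z natrB//.
    have -> : (l n).-2%:R = (l n)%:R - 2 :> R.
      by rewrite -subn2 natrB.
    by field; rewrite !gt_eqF.
  have z0 : 0 <= z by rewrite /z !mulr_ge0// ?invr_ge0// ltW.
  have [i i1 i2] := grid_below K0 v0 z0.
  rewrite -/(zz i) in i1 i2.
  apply: (@le_trans _ _ ((expR (b * r%:R))%:E * X n (zz i))%E).
    rewrite lee_wpmul2l ?lee_fin ?expR_ge0//; apply: X_le => //.
    by case/andP: (zz_in i).
  apply: (expE _ _ (w - b * zz i / Delta)) => //.
    have : forall i, ((w - b * zz i / Delta)%:E <= rate n (X n (zz i)))%E by near: n.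
    exact.
  have dl : `|b| * (n%:R * (z - zz i) / Delta) <= n%:R * e.
    case/orP: i2 => i2.
      apply: (@le_trans _ _ (`|b| * (n%:R * (v / K%:R) / Delta))).
        rewrite ler_wpM2l// ler_wpM2r ?invr_ge0 ?(ltW Delta0)// ler_wpM2l//; lra.
      have -> : `|b| * (n%:R * (v / K%:R) / Delta) = n%:R * (`|b| * v / Delta / K%:R).
        by field; rewrite !gt_eqF.
      by rewrite ler_wpM2l// ler_pdivrMr.
    apply: (@le_trans _ _ (`|b| * `|(l n)%:R - n%:R * (v / Delta)|)) => //.
    rewrite ler_wpM2l//; apply: le_trans (ler_norm _).
    apply: (@le_trans _ _ (n%:R * (z - v) / Delta)).
      rewrite ler_wpM2r ?invr_ge0 ?(ltW Delta0)// ler_wpM2l//; lra.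
    have -> : n%:R * (z - v) / Delta = n%:R * z / Delta - n%:R * (v / Delta) by lra.
    by rewrite zE; have : 0 <= r%:R :> R by []; lra.
  have dl' : - b * (n%:R * (z - zz i) / Delta) <= n%:R * e.
    apply: le_trans dl; rewrite ler_wpM2r//.
    by rewrite !mulr_ge0// ?invr_ge0 ?(ltW Delta0)//; lra.
  have -> : b * r%:R - n%:R * (w - b * zz i / Delta) =
    b * ((l n)%:R - n%:R * (v / Delta)) - b * 2 - b * (n%:R * (z - zz i) / Delta)
     - n%:R * (w - v * (b / Delta)).
    have -> : r%:R = (l n)%:R - 2 - n%:R * z / Delta by rewrite zE; lra.
    by field; rewrite gt_eqF.
  by rewrite /w /theta; nra.
have q0 : 0 <= q by exact: expR_ge0.
apply: (@le_trans _ _ (c%:E * (q%:E + \sum_(r < (l n).-1) q%:E))%E).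
  have : (E n <= c%:E * ((expR (b * (l n).-1%:R))%:E * p n +
     \sum_(r < (l n).-1) (expR (b * r%:R))%:E *
        X n (((l n).-2 - r)%:R * Delta / n%:R)))%E by near: n.
  move=> /le_trans; apply; rewrite lee_wpmul2l ?lee_fin//.
  by apply: leeD => //; apply: lee_sum => r _; exact: Xq.
rewrite sumEFin -EFinD -EFinM lee_fin sumr_const card_ord -mulrS.
apply: (@le_trans _ _ (c * (n%:R * (v / Delta + 2)) * q)).
  rewrite -mulrA ler_wpM2l// -[q *+ _]mulr_natl ler_wpM2r//.
  have h5 : (l n)%:R <= n%:R * (v / Delta + 1) by near: n.
  have n1 : 1 <= n%:R :> R by rewrite ler1n.
  have : (l n).-1%:R <= (l n)%:R :> R by rewrite ler_nat leq_pred.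
  by rewrite -natr1; lra.
have h6 : c * (n%:R * (v / Delta + 2)) <= expR (n%:R * e) by near: n.
apply: le_trans (ler_wpM2r q0 h6) _.
by rewrite /q -expRD ler_expR; lra.
Unshelve. all: by end_near.
Qed.

Lemma rate_upper_bound :
  (\forall n \near \oo, ((expR (b * (l n)%:R))%:E * p n <= E n)%E) ->
  forall t : R, (W - (v * (b / Delta))%:E < t%:E)%E ->
    \forall n \near \oo, (rate n (E n) <= t%:E)%E.
Proof.
move=> E_ge t tW; pose theta := t + v * (b / Delta).
have thetaW : (W < theta%:E)%E by rewrite /theta EFinD -lteBlDr.
have [e e0 eW] : exists2 e, 0 < e & (W < (theta - e)%:E)%E.
  case: (W) W_Ny thetaW => [w| |] //= _.
  by rewrite lte_fin => tw; exists ((theta - w) / 2); rewrite ?lte_fin; lra.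
have H1 := near_le rate_p eW.
have H3 := l_near e0.
apply: filterS3 E_ge H1 H3 => n En pn [n0 ln].
rewrite rate_le//; move: pn; rewrite rate_le// => pn.
apply: le_trans En.
apply: (@le_trans _ _ ((expR (b * (l n)%:R))%:E * (expR (- (n%:R * (theta - e))))%:E)%E); last first.
  by rewrite lee_wpmul2l// lee_fin expR_ge0.
rewrite -EFinM -expRD lee_fin ler_expR.
have : - (b * ((l n)%:R - n%:R * (v / Delta))) <= n%:R * e.
  by apply: le_trans ln; rewrite -normrM -normrN ler_norm.
have -> : b * (l n)%:R = b * ((l n)%:R - n%:R * (v / Delta)) + n%:R * (v * (b / Delta)).
  by field; rewrite gt_eqF.
by rewrite /theta; lra.
Qed.

End asymptotics.

Lemma lt_limn_einf {R : realType} (u : nat -> \bar R) (t : \bar R) :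
  (t < limn_einf u)%E -> \forall n \near \oo, (t < u n)%E.
Proof.
rewrite limn_einf_lim (cvg_lim _ (@cvg_einfs_sup _ u))// => /ereal_sup_gt[_ [N _ <-]] tN.
exists N => // n /= Nn; apply: lt_le_trans tN _; apply: ereal_inf_lbound.
by exists n.
Qed.

(** * Splitting mechanism and levels *)

Section mechanism.
Context {R : realType} {J : nat} (mech : splitting_mechanism R J).
Local Notation rho := (mech_E mech (fun j => (offspring mech j)%:R)).
Local Notation kappa := (mech_E mech (@weight_sum R J mech 2)).

Lemma mech_E_ge0 f : (forall j, 0 <= f j) -> 0 <= mech_E mech f.
Proof. by move=> f0; apply: sumr_ge0 => j _; rewrite mulr_ge0// mech_law_ge0. Qed.

(* From [2 w <= s w ^ 2 + 1 / s], summed over the offspring. *)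
Let amgm s : unbiased mech -> 0 < s -> 2 <= s * kappa + rho / s.
Proof.
move=> unb s0.
have -> : s * kappa + rho / s = mech_E mech (fun j => \sum_(k < offspring mech j) (s * weight k ^+ 2 + s^-1)).
  rewrite /mech_E mulr_sumr mulr_suml -big_split/=; apply: eq_bigr => j _.
  rewrite big_split/= -mulr_sumr sumr_const card_ord -[s^-1 *+ _]mulr_natl /weight_sum.
  by ring.
have -> : 2 = mech_E mech (fun j => \sum_(k < offspring mech j) 2 * weight k) :> R.
  rewrite -[LHS]mulr1 -unb /mech_E mulr_sumr; apply: eq_bigr => j _.
  by rewrite -mulr_sumr; ring.
apply: ler_sum => j _; rewrite ler_wpM2l ?mech_law_ge0//; apply: ler_sum => k _.
have : 0 <= (s * weight k - 1) ^+ 2 / s by rewrite divr_ge0 ?sqr_ge0// ltW.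
have -> : (s * weight k - 1) ^+ 2 / s = s * weight k ^+ 2 + s^-1 - 2 * weight k.
  by field; rewrite gt_eqF.
by rewrite subr_ge0.
Qed.

(** If kappa were 0, [amgm] with [s = rho + 1] would give [2 <= rho / (rho + 1)]. *)
Lemma sqr_weight_gt0 : unbiased mech -> 0 < kappa.
Proof.
move=> unb; rewrite lt_neqAle mech_E_ge0 ?andbT; last by move=> j; exact: weight_sum_ge0.
apply/eqP => k0; have r0 : 0 <= rho by apply: mech_E_ge0.
have s0 : 0 < rho + 1 by rewrite ltr_wpDl.
have := amgm unb s0; rewrite -k0 mulr0 add0r ler_pdivlMr//; lra.
Qed.

(** Take [s = 1 / kappa] in [amgm]. *)
Lemma offspring_sqr_weight : unbiased mech -> 1 <= rho * kappa.
Proof.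
move=> unb; have k0 := sqr_weight_gt0 unb.
have kV : 0 < kappa^-1 by rewrite invr_gt0.
have := amgm unb kV; rewrite mulVf ?gt_eqF// invrK; lra.
Qed.

Lemma ln_offspring_sqr_weight : unbiased mech -> 0 <= ln rho + ln kappa.
Proof.
move=> unb; have k0 := sqr_weight_gt0 unb; have h := offspring_sqr_weight unb.
have r0 : 0 < rho by rewrite -(pmulr_lgt0 _ k0) (lt_le_trans ltr01).
by rewrite -lnM ?posrE// ln_ge0.
Qed.

End mechanism.

Section levels.
Context {R : realType} {d : nat}.
Variables (D B : set 'rV[R]_d) (V : 'rV[R]_d -> R) (Delta : R).
Hypotheses (D_open : open D) (V_cont : {within D, continuous V}).
Hypotheses (V_B : forall y, B y -> V y <= 0) (B_sub : B `<=` D) (Delta_gt0 : 0 < Delta).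
Hypothesis mB : measurable B.

Lemma nbhs_gt_importance y z : D y -> z < V y -> nbhs y [set u | D u /\ z < V u].
Proof.
move=> Dy zV; have e0 : 0 < V y - z by rewrite subr_gt0.
have [r r0 Hr] := within_continuous_ball V_cont Dy e0.
have nD : nbhs y D by apply: open_nbhs_nbhs.
have nb : nbhs y (ball y r) by exact: nbhsx_ballx.
apply: filterS2 nD nb => u Du; rewrite -ball_normE => yu; split=> //.
by have := Hr u Du yu; rewrite ltr_norml => /andP[_]; lra.
Qed.

Lemma nbhs_lt_importance y z : D y -> V y < z -> nbhs y [set u | D u /\ V u < z].
Proof.
move=> Dy zV; have e0 : 0 < z - V y by rewrite subr_gt0.
have [r r0 Hr] := within_continuous_ball V_cont Dy e0.
have nD : nbhs y D by apply: open_nbhs_nbhs.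
have nb : nbhs y (ball y r) by exact: nbhsx_ballx.
apply: filterS2 nD nb => u Du; rewrite -ball_normE => yu; split=> //.
by have := Hr u Du yu; rewrite ltr_norml => /andP[+ _]; lra.
Qed.

(** Continuity of [V] is available within [D] only, so the sublevel set is written as [D] minus an
    open subset of [D]. *)
Lemma measurable_sublevel z : measurable (sublevel D V z).
Proof.
have -> : sublevel D V z = D `\` [set u | D u /\ z < V u].
  apply/seteqP; split=> u.
    by move=> [Du Vu]; split=> // -[_]; rewrite ltNge Vu.
  by move=> [Du nV]; split=> //; rewrite leNgt; apply/negP => zV; exact: nV.
apply: measurableD; apply: measurable_open => //.
rewrite openE => y [Dy zy]; exact: nbhs_gt_importance.
Qed.

Lemma measurable_level n j : measurable (C_level D B V Delta n j).
Proof. by case: j => [|j] //=; exact: measurable_sublevel. Qed.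

Lemma sub_sublevel z : 0 <= z -> B `<=` sublevel D V z.
Proof. by move=> z0 y By; split; [exact: B_sub|exact: le_trans (V_B By) z0]. Qed.

Lemma sublevel_le z z' : z <= z' -> sublevel D V z `<=` sublevel D V z'.
Proof. by move=> zz y [Dy Vy]; split=> //; exact: le_trans Vy zz. Qed.

Lemma level_le n i j : (i <= j)%N -> C_level D B V Delta n i `<=` C_level D B V Delta n j.
Proof.
have lev0 k : 0 <= k%:R * Delta / n%:R by rewrite divr_ge0// mulr_ge0// ltW.
case: i j => [|i] [|j] ij /=; [by []|exact: sub_sublevel|by []|].
apply: sublevel_le; rewrite ler_wpM2r ?invr_ge0// ler_wpM2r ?(ltW Delta_gt0)// ler_nat.
exact: ij.
Qed.

(** The lower bound on [V y] is restricted to [1 < l]: when [l = 1] the preceding level is [B], and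
    [V y] may be negative. *)
Lemma level_indexP n y : (0 < n)%N -> D y -> ~ B y ->
  let l := level_index D B V Delta n y in
  [/\ (0 < l)%N, V y <= l.-1%:R * Delta / n%:R &
      (1 < l)%N -> l.-2%:R * Delta / n%:R < V y].
Proof.
move=> n0 Dy nBy /=; have n0R : 0 < n%:R :> R by rewrite ltr0n.
rewrite /level_index; case H : first_index => [l|] /=; last first.
  (* Some level contains [y] by the Archimedean property, so the default value in [level_index] does
     not occur. *)
  have := (first_indexN _).1 H (Num.bound (`|V y| * n%:R / Delta)).+1.
  case; split=> //=; apply: le_trans (ler_norm _) _.
  rewrite ler_pdivlMr// -ler_pdivrMr// ltW//; apply: archi_boundP.
  by rewrite divr_ge0 ?mulr_ge0// ltW.
have [Cl nC] := (first_indexP _ _).1 H.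
case: l Cl nC {H} => [|l] Cl nC //=; split=> //; first by case: Cl.
case: l Cl nC => [|l] // Cl nC _ /=; rewrite ltNge; apply/negP => Vl.
by apply: (nC l.+1).
Qed.

Lemma level_index_cvg (x_ : nat -> 'rV[R]_d) x : D x -> 0 <= V x ->
  (forall n, D (x_ n) /\ ~ B (x_ n)) -> x_ @ \oo --> x ->
  (level_index D B V Delta n (x_ n))%:R / n%:R @[n --> \oo] --> V x / Delta.
Proof.
move=> Dx Vx0 x_in x_cvg; apply/cvgrPdist_le => e e0.
have e20 : 0 < e * Delta / 2 by rewrite !mulr_gt0.
have [r r0 Hr] := within_continuous_ball V_cont Dx e20.
have near_x : \forall n \near \oo, `|x - x_ n| < r by move/cvgrPdist_lt : x_cvg => /(_ _ r0).
near=> n.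
have n0 : (0 < n)%N by near: n; exact: nbhs_infty_gt.
have n0R : 0 < n%:R :> R by rewrite ltr0n.
have [Dn nBn] := x_in n.
have [l0 Vl lV] := level_indexP n0 Dn nBn.
set l := level_index _ _ _ _ _ _ in l0 Vl lV *.
have Vd : `|V x - V (x_ n)| < e * Delta / 2 by apply: Hr => //; near: n.
(* The constant 4 makes a shift by two levels cost at most half of the tolerance. *)
have ne : 4 <= n%:R * e.
  have : 4 / e <= n%:R by near: n; exact: nbhs_infty_ger.
  by rewrite ler_pdivrMr.
move: Vd; rewrite ltr_norml => /andP[Vd1 Vd2].
have lE : l.-1%:R = l%:R - 1 :> R by rewrite -subn1 natrB.
rewrite ler_pdivlMr// in Vl; rewrite lE in Vl.
rewrite ler_norml; apply/andP; split.
  suff : l%:R / n%:R <= V x / Delta + e by lra.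
  have -> : V x / Delta + e = (n%:R * (V x + e * Delta)) / Delta / n%:R.
    by field; rewrite !gt_eqF.
  rewrite ler_wpM2r ?invr_ge0 ?(ltW n0R)// ler_pdivlMr//.
  (* For [l = 1] the bound rests on [0 <= V x]. *)
  have [l1|l1] := leqP l 1.
    have -> : l = 1%N by apply/eqP; rewrite eqn_leq l1 l0.
    have : 4 * Delta <= n%:R * e * Delta by rewrite ler_wpM2r// ltW.
    have : 0 <= n%:R * V x by rewrite mulr_ge0.
    by move: Delta_gt0; nra.
  have := lV l1; have -> : l.-2%:R = l%:R - 2 :> R by rewrite -subn2 natrB.
  rewrite ltr_pdivrMr// => h.
  have : n%:R * V (x_ n) <= n%:R * (V x + e * Delta / 2) by rewrite ler_wpM2l ?ltW//; lra.
  have : 4 * Delta <= n%:R * e * Delta by rewrite ler_wpM2r// ltW.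
  by move: h; rewrite mulrC; nra.
suff : V x / Delta - e <= l%:R / n%:R by lra.
have -> : V x / Delta - e = (n%:R * (V x - e * Delta)) / Delta / n%:R.
  by field; rewrite !gt_eqF.
rewrite ler_wpM2r ?invr_ge0 ?(ltW n0R)// ler_pdivrMr//.
have : n%:R * (V x - e * Delta / 2) <= n%:R * V (x_ n) by rewrite ler_wpM2l ?ltW//; lra.
have : 4 * Delta <= n%:R * e * Delta by rewrite ler_wpM2r// ltW.
by move: Vl Delta_gt0; rewrite mulrC; nra.
Unshelve. all: by end_near.
Qed.

End levels.

(** * Lower bound for W on the level boundaries *)

Section importance_bound.
Context {R : realType} {d : nat}.
Variables (D A B : set 'rV[R]_d) (L : 'rV[R]_d -> 'rV[R]_d -> \bar R).
Variables (V U : 'rV[R]_d -> R) (a b Delta : R).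
Hypotheses (D_open : open D) (V_cont : {within D, continuous V}) (B_sub : B `<=` D).
Hypotheses (L0 : forall u v, (0 <= L u v)%E) (Delta_gt0 : 0 < Delta) (ab : 0 <= a + b).
Hypothesis U_def : forall y, D y -> U y = a / Delta * V y.
Hypothesis U_sub : forall y z, (D `\` (A `|` B)) y -> (D `\` (A `|` B)) z ->
  ((U y - U z)%:E <= J_fun D L y z)%E.
Hypothesis U_B : forall y, B y -> U y <= 0.

Lemma W_fun_ge_importance y : D y -> ((a / Delta * V y)%:E <= W_fun D A B L y)%E.
Proof.
move=> Dy; apply: (@subsolution_le_W R d D A B L (fun y => a / Delta * V y)) => //.
- have /subspace_continuousP Vc := V_cont.
  by apply/subspace_continuousP => u Du; apply: cvgM; [exact: cvg_cst|exact: Vc].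
- by move=> u w uD wD; rewrite -!U_def; [exact: U_sub|case: wD|case: uD].
- by move=> u Bu; rewrite -U_def; [exact: U_B|exact: B_sub].
Qed.

(** If [b >= 0] the left side is at most 0. If [b < 0], then [a >= - b > 0]; moreover [V y >= z],
    because points of [D] with [V < z] are interior to the sublevel set, and the chain [W >= a V /
    Delta >= a z / Delta >= - b z / Delta] follows. *)
Lemma W_fun_sublevel_boundary z y : 0 <= z -> sublevel_boundary D V z y ->
  ((- (b * z / Delta))%:E <= W_fun D A B L y)%E.
Proof.
move=> z0 [Dy [_ nint]].
have zD : 0 <= z / Delta by rewrite divr_ge0// ltW.
have [b0|b0] := leP 0 b.
  apply: (@le_trans _ _ 0%E); last exact: W_fun_ge0.
  by rewrite lee_fin oppr_le0 -mulrA mulr_ge0.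
have zV : z <= V y.
  rewrite leNgt; apply/negP => Vz; apply: nint.
  have := nbhs_lt_importance D_open V_cont Dy Vz; rewrite /interior/=.
  by apply: filterS => u [Du /ltW Vu].
apply: (@le_trans _ _ (a / Delta * V y)%:E); last exact: W_fun_ge_importance.
rewrite lee_fin.
have zVD : z / Delta <= V y / Delta by rewrite ler_wpM2r// invr_ge0 ltW.
have -> : a / Delta * V y = a * (V y / Delta) by rewrite mulrAC mulrA.
rewrite -mulrA -mulNr.
apply: (@le_trans _ _ (a * (z / Delta))); first by rewrite ler_wpM2r// -subr_ge0 opprK.
rewrite ler_wpM2l//; apply: (@le_trans _ _ (- b)); first by rewrite oppr_ge0 ltW.
by rewrite -subr_ge0 opprK.
Qed.

End importance_bound.

(** * Second moment bounds for the levels of V *)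

Section run_bounds.
Local Open Scope ereal_scope.
Context {R : realType} {d J : nat} {D : set 'rV[R]_d} {X : markov_chain D}
  {mech : splitting_mechanism R J} {A B : set 'rV[R]_d} {V : 'rV[R]_d -> R}
  {Delta : R} {n : nat} {x : 'rV[R]_d}.
Local Notation l := (level_index D B V Delta n x).
Variable S : splitting_run X mech A (C_level D B V Delta n) l x.
Hypotheses (D_open : open D) (mA : measurable A) (mB : measurable B)
  (AB : A `&` B = set0) (B_sub : B `<=` D).
Hypotheses (V_cont : {within D, continuous V}) (V_B : forall y, B y -> (V y <= 0)%R).
Hypotheses (Delta_gt0 : (0 < Delta)%R) (unb : unbiased mech).
Hypotheses (Dx : D x) (l0 : (0 < l)%N).

Local Notation kappa := (mech_E mech (@weight_sum R J mech 2)).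
Local Notation c2 := (mech_E mech (fun m => @weight_sum R J mech 1 m ^+ 2)%R).
Local Notation p := (reach X A B x).

Let mlev j : measurable (C_level D B V Delta n j).
Proof. exact: measurable_level. Qed.

Let expR_kappa r : expR (ln kappa * r%:R) = (kappa ^+ r)%R.
Proof. by rewrite expRM_natr lnK// posrE; exact: sqr_weight_gt0. Qed.

Lemma run_sqr_ge :
  (expR (ln kappa * l%:R))%:E * p <= \int[run_prob S]_w (s_SA w ^+ 2)%:E.
Proof.
rewrite expR_kappa; apply: sample_sqr_ge => //.
by move=> i j; exact: level_le.
Qed.

(** The term [p ^ 2] is absorbed by the summand [r = 0], whence the constant [1 + c2]. The last
    summand has target [B], where [p] is 1 outside [A], and so reduces to a multiple of [p]; the
    others are cross moments at sublevel sets. *)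
Lemma run_sqr_le :
  \int[run_prob S]_w (s_SA w ^+ 2)%:E <= (1 + c2)%:E *
    ((expR (ln kappa * l.-1%:R))%:E * p + \sum_(r < l.-1) (expR (ln kappa * r%:R))%:E *
      cross_moment X A B (sublevel D V ((l.-2 - r)%:R * Delta / n%:R)) x).
Proof.
have lle i j : (i <= j)%N -> C_level D B V Delta n i `<=` C_level D B V Delta n j.
  exact: level_le.
have c20 : (0 <= c2)%R by apply: mech_E_ge0 => m; rewrite exprn_ge0// weight_sum_ge0.
set s := _ + _.
pose G r := (kappa ^+ r)%:E *
    pot (chain_ker X) A (C_level D B V Delta n (l - r.+1)) (fun y => reach X A B y ^+ 2) x.
have sE : s = \sum_(r < l) G r.
  have -> : \sum_(r < l) G r = \sum_(r < l.-1.+1) G r by rewrite prednK.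
  rewrite big_ord_recr/= addeC /s /G; congr (_ + _).
    rewrite expR_kappa prednK// subnn/=; congr (_ * _).
    apply: eq_pot => z [Bz Az].
    by rewrite [reach X A B z](@pot_on _ _ _ X _ mA B (cst 1))//= mule1.
  apply: eq_bigr => r _; rewrite expR_kappa cross_moment_pot//; last exact: measurable_sublevel.
  (* Level [j.+1] is the sublevel set at [j * Delta / n]: hence [l.-2 - r]. *)
  have -> : (l - r.+1 = (l.-2 - r).+1)%N.
    by move: (nat_of_ord r) (ltn_ord r) => m; case: (l) => [|[|k]] //= mk; rewrite subSS subSn.
  by [].
have s1 : p ^+ 2 <= s.
  have t0 r : 0 <= G r.
    rewrite mule_ge0// ?lee_fin ?exprn_ge0 ?(ltW (sqr_weight_gt0 unb))//.
    by apply: pot_ge0 => y; rewrite expe_ge0// reach_ge0.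
  have h := reach_sqr_le X mA mB Dx (mlev l.-1) (lle _ _ (leq0n _)).
  apply: (le_trans h); rewrite sE (bigD1 (Ordinal l0))//= {1}/G expr0 mul1e subn1.
  by rewrite leeDl//; apply: sume_ge0.
have h := sample_sqr_le S mA mB mlev erefl lle Dx l0 unb.
apply: (le_trans h).
by rewrite -sE EFinD ge0_muleDl ?lee_fin// mul1e leeD2r.
Qed.

End run_bounds.

(** * The exponential rate of the second moment *)

Unset Implicit Arguments.
Set Strict Implicit.
Set Printing Implicit Defensive.

Theorem theorem8 (R : realType) (d : nat) (hd : (0 < d)%N)
  (D A B : set 'rV[R]_d)
  (D_open : open D) (D_connected : connected D)
  (A_measurable : measurable A) (B_measurable : measurable B)
  (A_sub : A `<=` D) (B_sub : B `<=` D) (AB_disjoint : A `&` B = set0)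
  (X : nat -> markov_chain D)
  (L : 'rV[R]_d -> 'rV[R]_d -> \bar R)
  (L_ge0 : forall u v, (0%E <= L u v)%E)
  (V : 'rV[R]_d -> R) (V_continuous : {within D, continuous V})
  (V_B : forall y, B y -> V y <= 0)
  (Delta : R) (Delta_gt0 : 0 < Delta)
  (J : nat) (mech : splitting_mechanism R J) (mech_unbiased : unbiased mech)
  (Wbar : 'rV[R]_d -> R)
  (Wbar_def : forall y, D y ->
     Wbar y = ln (mech_E mech (fun j => (offspring mech j)%:R)) / Delta * V y)
  (x : 'rV[R]_d) (x_in : (D `\` (A `|` B)) x) (Vx_ge0 : 0 <= V x)
  (x_ : nat -> 'rV[R]_d) (x_n_in : forall n, (D `\` (A `|` B)) (x_ n))
  (x_n_cvg : x_ @ \oo --> x)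
  (S : forall n, splitting_run (X n) mech A (C_level D B V Delta n)
                   (level_index D B V Delta n (x_ n)) (x_ n))
  (Wbar_subsolution : forall y z,
     (D `\` (A `|` B)) y -> (D `\` (A `|` B)) z ->
     ((Wbar y - Wbar z)%:E <= J_fun D L y z)%E)
  (Wbar_B : forall y, B y -> Wbar y <= 0)
  (hit_prob_rate : forall y_ : nat -> 'rV[R]_d,
     (forall n, D (y_ n)) -> y_ @ \oo --> x ->
     rate n (hit_prob (X n) A B (y_ n)) @[n --> \oo] --> W_fun D A B L x)
  (cross_moment_rate : forall z : R, 0 <= z <= V x ->
     (W_fun D A B L x +
        ereal_inf [set W_fun D A B L y | y in sublevel_boundary D V z] <=
      limn_einf (fun n =>
        rate n (cross_moment (X n) A B (sublevel D V z) (x_ n))))%E) :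
  rate n 'E_(run_prob (S n))[fun w => s_SA w ^+ 2] @[n --> \oo] -->
    (W_fun D A B L x -
      (V x * (ln (mech_E mech (fun j => \sum_(k < offspring mech j) weight k ^+ 2))
              / Delta))%:E)%E.
Proof.
pose a := ln (mech_E mech (fun j => (offspring mech j)%:R)).
pose b := ln (mech_E mech (@weight_sum R J mech 2)).
pose c2 := mech_E mech (fun m => @weight_sum R J mech 1 m ^+ 2).
have ab : 0 <= a + b by exact: ln_offspring_sqr_weight.
have c0 : 0 <= 1 + c2.
  by rewrite addr_ge0//; apply: mech_E_ge0 => m; rewrite exprn_ge0// weight_sum_ge0.
have Dn n : D (x_ n) by case: (x_n_in n).
have nBn n : ~ B (x_ n) by case: (x_n_in n) => _ h Bx; apply: h; right.
have W0 : (0 <= W_fun D A B L x)%E by exact: W_fun_ge0.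
have W_Ny : W_fun D A B L x != -oo%E.
  by apply/eqP => WE; move: W0; rewrite WE leNgt ltNyr.
pose E n := (\int[run_prob (S n)]_w (s_SA w ^+ 2)%:E)%E.
pose p n := reach (X n) A B (x_ n).
pose Y n z := cross_moment (X n) A B (sublevel D V z) (x_ n).
pose l n := level_index D B V Delta n (x_ n).
have E0 n : (0 <= E n)%E by apply: integral_ge0 => w _; rewrite lee_fin sqr_ge0.
have p0 n : (0 <= p n)%E by exact: reach_ge0.
have mS z : measurable (sublevel D V z) by exact: measurable_sublevel.
have YE n z : Y n z = pot (chain_ker (X n)) A (sublevel D V z) (fun y => reach (X n) A B y ^+ 2)%E (x_ n).
  by rewrite /Y cross_moment_pot.
have Y0 n z : (0 <= Y n z)%E.
  by rewrite YE; apply: pot_ge0 => y; rewrite expe_ge0// reach_ge0.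
have rate_p : rate n (p n) @[n --> \oo] --> W_fun D A B L x.
  have := hit_prob_rate x_ Dn x_n_cvg.
  by under eq_fun do rewrite hit_prob_reach//.
(* The boundary estimate bounds the infimum of W below by [- b z / Delta], also when the boundary is
   empty and the infimum is [+oo]. *)
have rate_Y (z t : R) : 0 <= z <= V x -> ((t + b * z / Delta)%:E < W_fun D A B L x)%E ->
    \forall n \near \oo, (t%:E <= rate n (Y n z))%E.
  move=> zI tW; have /andP[z0 _] := zI.
  suff tl : (t%:E < limn_einf (fun n => rate n (Y n z)))%E.
    by apply: filterS (lt_limn_einf tl) => n /ltW.
  apply: lt_le_trans (cross_moment_rate z zI).
  apply: (@lt_le_trans _ _ (W_fun D A B L x + (- (b * z / Delta))%:E)%E).
    by rewrite EFinN lteBrDr// -EFinD.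
  rewrite leeD2l//; apply: le_ereal_inf_tmp => _ [y yz <-].
  exact: (W_fun_sublevel_boundary D_open V_continuous B_sub L_ge0 Delta_gt0 ab
    Wbar_def Wbar_subsolution Wbar_B z0 yz).
have Y_le n z z' : 0 <= z -> z <= z' -> (Y n z' <= Y n z)%E.
  move=> z0 zz; rewrite !YE; apply: pot_reach_sqr_le => //.
  - exact: sub_sublevel.
  - exact: sublevel_le.
have l_cvg : (l n)%:R / n%:R @[n --> \oo] --> V x / Delta.
  apply: level_index_cvg => //; first by case: x_in.
have near0 : \forall n \near \oo, (0 < n)%N by exact: nbhs_infty_gt.
have l0 n : (0 < n)%N -> (0 < l n)%N.
  by move=> n0; have [] := level_indexP V Delta_gt0 n0 (Dn n) (@nBn n).
under eq_fun do rewrite unlock.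
apply: (@cvge_bounds R (fun n => rate n (E n))).
- by case: (W_fun D A B L x) W_Ny.
- apply: (@rate_lower_bound R E p Y l _ (V x) b Delta (1 + c2)) => //.
  apply: filterS near0 => n /l0 ln0; exact: run_sqr_le.
- apply: (@rate_upper_bound R E p l _ (V x) b Delta) => //.
  apply: filterS near0 => n /l0 ln0; exact: run_sqr_ge.
Qed.
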